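(* For every positive integer $N$, there exists a (first-order) structure $M$ whose Grothendieck ring $K_0(M)$ is isomorphic to $(\mathbb{Z}/N\mathbb{Z})[X]$.
   Context: For a non-empty first-order structure $M$, let $\mathrm{Def}(M)$ be the set of subsets of finite Cartesian powers $M^n$ that are definable with parameters. Two such sets are identified if there is a definable bijection between them; on the quotient $\widetilde{\mathrm{Def}}(M)$, addition is induced by disjoint union (the class of a disjoint union of representatives) and multiplication by Cartesian product, making it a commutative semi-ring. Identifying $a,b$ whenever $a+c=b+c$ for some $c$ gives a cancellative semi-ring, and the Grothendieck ring $K_0(M)$ is the smallest ring containing it (its ring of formal differences). *)

(* Defs.v *)
From HB Require Import structures.
From mathcomp Require Import all_boot all_algebra.
From mathcomp Require Import boolp classical_sets functions.

Set Implicit Arguments.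
Unset Strict Implicit.
Unset Printing Implicit Defensive.

Import GRing.Theory.
Local Open Scope classical_set_scope.
Local Open Scope quotient_scope.

Record signature := Signature {
  fsymb : Type;
  farity : fsymb -> nat;
  rsymb : Type;
  rarity : rsymb -> nat }.

Record structure (L : signature) := Structure {
  carrier :> Type;
  carrier_inhabited : inhabited carrier;
  finterp : forall f : fsymb L, (farity f).-tuple carrier -> carrier;
  rinterp : forall r : rsymb L, (rarity r).-tuple carrier -> Prop }.

Section Formulas.
Variables (L : signature) (M : structure L).

(** Terms and formulas of the language of [L] expanded by a constant for each
    element of [M], with free variables among [x_0, ..., x_(n-1)]. The variable
    bound by [FEx] is [x_0] of its body (the others are shifted by one). *)
Inductive term (n : nat) : Type :=
| Var of 'I_n
| Par of M
| App (f : fsymb L) of ('I_(farity f) -> term n).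

Inductive formula : nat -> Type :=
| FEq n of term n & term n : formula n
| FRel n (r : rsymb L) of ('I_(rarity r) -> term n) : formula n
| FNot n of formula n : formula n
| FAnd n of formula n & formula n : formula n
| FEx n of formula n.+1 : formula n.

Fixpoint eval n (x : n.-tuple M) (t : term n) : M :=
  match t with
  | Var i => tnth x i
  | Par a => a
  | App f args => finterp [tuple eval x (args i) | i < farity f]
  end.

Fixpoint holds n (phi : formula n) : n.-tuple M -> Prop :=
  match phi with
  | FEq _ s t => fun x => eval x s = eval x t
  | FRel _ r args => fun x => rinterp [tuple eval x (args i) | i < rarity r]
  | FNot _ p => fun x => ~ holds p x
  | FAnd _ p q => fun x => holds p x /\ holds q x
  | FEx _ p => fun x => exists a : M, holds p [tuple of a :: x]
  end.

Definition definable n (A : set (n.-tuple M)) : Prop :=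
  exists phi : formula n, A = [set x | holds phi x].

Record dset := DSet {
  dim : nat;
  points :> set (dim.-tuple M);
  points_definable : definable points }.

Definition definably_bijective n m (A : set (n.-tuple M)) (B : set (m.-tuple M))
    : Prop :=
  exists f : n.-tuple M -> m.-tuple M,
    set_bij A B f /\ definable [set cat_tuple x (f x) | x in A].

Definition setprod_tuple n m (A : set (n.-tuple M)) (B : set (m.-tuple M))
    : set ((n + m).-tuple M) :=
  [set cat_tuple x y | x in A & y in B].

(** Disjoint copies of [A] and [B] in a common power of [M]: pad with constant
    coordinates and tag the last coordinate by [a] for [A], by [b] for [B]. *)
Definition inj_left (a : M) n m (x : n.-tuple M) : (n + (m + 1)).-tuple M :=
  cat_tuple x (cat_tuple (nseq_tuple m a) [tuple a]).

Definition inj_right (a b : M) n m (y : m.-tuple M) : (n + (m + 1)).-tuple M :=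
  cat_tuple (nseq_tuple n a) (cat_tuple y [tuple b]).

Arguments inj_left a {n} m x.
Arguments inj_right a b n {m} y.

Definition setsum_tuple (a b : M) n m
    (A : set (n.-tuple M)) (B : set (m.-tuple M)) : set ((n + (m + 1)).-tuple M) :=
  inj_left a m @` A `|` inj_right a b n @` B.

End Formulas.

Arguments Par {L M n}.
Arguments inj_left {L M} a {n} m x.
Arguments inj_right {L M} a b n {m} y.

Section Definability.
Variables (L : signature) (M : structure L).
Implicit Types (n m k : nat).

Local Notation term := (term M).
Local Notation formula := (formula M).
Local Notation env := (nat -> M).

Fixpoint tsubst n m (s : 'I_n -> term m) (t : term n) : term m :=
  match t with
  | Var i => s i
  | Par a => Par a
  | App f args => App (fun i => tsubst s (args i))
  end.

Lemma eval_tsubst n m (s : 'I_n -> term m) t (x : m.-tuple M) :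
  eval x (tsubst s t) = eval [tuple eval x (s i) | i < n] t.
Proof.
elim: t => [i|a|f args IH] //=; first by rewrite tnth_mktuple.
by congr finterp; apply: eq_from_tnth => i; rewrite !tnth_mktuple.
Qed.

Definition up n m (s : 'I_n -> term m) (i : 'I_n.+1) : term m.+1 :=
  if unlift ord0 i is Some j then tsubst (fun v => Var M (lift ord0 v)) (s j)
  else Var M ord0.

Fixpoint fsubst n (phi : formula n) : forall m, ('I_n -> term m) -> formula m :=
  match phi with
  | FEq _ t u => fun m s => FEq (tsubst s t) (tsubst s u)
  | FRel _ r args => fun m s => FRel (fun i => tsubst s (args i))
  | FNot _ p => fun m s => FNot (fsubst p s)
  | FAnd _ p q => fun m s => FAnd (fsubst p s) (fsubst q s)
  | FEx _ p => fun m s => FEx (fsubst p (up s))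
  end.

Lemma eval_shift n (x : n.-tuple M) a (t : term n) :
  eval [tuple of a :: x] (tsubst (fun v => Var M (lift ord0 v)) t) = eval x t.
Proof.
rewrite eval_tsubst; congr (eval _ t).
by apply: eq_from_tnth => i; rewrite tnth_mktuple /= tnthS.
Qed.

Lemma holds_fsubst n (phi : formula n) m (s : 'I_n -> term m) (x : m.-tuple M) :
  holds (fsubst phi s) x <-> holds phi [tuple eval x (s i) | i < n].
Proof.
elim: phi m s x => {n} [n t u|n r args|n p IH|n p IHp q IHq|n p IH] m s x /=.
- by rewrite !eval_tsubst.
- have -> // : [tuple eval x (tsubst s (args i)) | i < rarity r] =
     [tuple eval [tuple eval x (s i) | i < n] (args i) | i < rarity r].
  by apply: eq_from_tnth => i; rewrite !tnth_mktuple eval_tsubst.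
- by rewrite IH.
- by rewrite IHp IHq.
- have E a : [tuple eval [tuple of a :: x] (up s i) | i < n.+1] =
     [tuple of a :: [tuple eval x (s i) | i < n]].
    apply: eq_from_tnth => i; rewrite tnth_mktuple /up.
    by case: unliftP => [j|] ->; rewrite ?tnthS ?tnth_mktuple ?eval_shift ?tnth0.
  have {}IH a := IH _ (up s) [tuple of a :: x].
  split=> -[a Ha]; exists a; first by rewrite -E; apply: (IH a).1.
  by apply: (IH a).2; rewrite E.
Qed.

Definition pre n (e : env) : n.-tuple M := [tuple e i | i < n].
Lemma tnth_pre n e i : tnth (pre n e) i = e i.
Proof. by rewrite tnth_mktuple. Qed.

Definition shift n (e : env) : env := fun i => e (n + i)%N.

(** [dp P]: the predicate [P] on valuations is defined by a formula. *)
Definition dp (P : env -> Prop) : Prop :=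
  exists k (phi : formula k), forall e, P e <-> holds phi (pre k e).

Lemma dp_ext P Q : (forall e, P e <-> Q e) -> dp P -> dp Q.
Proof. by move=> E [k [phi H]]; exists k, phi => e; rewrite -E. Qed.

Lemma dp_ge P : dp P -> exists k, forall m, (k <= m)%N ->
  exists phi : formula m, forall e, P e <-> holds phi (pre m e).
Proof.
move=> [k [phi H]]; exists k => m km.
exists (fsubst phi (fun i => Var M (widen_ord km i))) => e.
rewrite holds_fsubst H; have -> // : pre k e =
   [tuple eval (pre m e) (Var M (widen_ord km i)) | i < k].
by apply: eq_from_tnth => i; rewrite tnth_pre tnth_mktuple /= tnth_pre.
Qed.

Lemma dp_not P : dp P -> dp (fun e => ~ P e).
Proof. by move=> [k [phi H]]; exists k, (FNot phi) => e /=; rewrite H. Qed.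

Lemma dp_and P Q : dp P -> dp Q -> dp (fun e => P e /\ Q e).
Proof.
move=> /dp_ge[k Hk] /dp_ge[l Hl].
have [phi Hphi] := Hk _ (leq_maxl k l); have [psi Hpsi] := Hl _ (leq_maxr k l).
by exists (maxn k l), (FAnd phi psi) => e /=; rewrite Hphi Hpsi.
Qed.

Lemma dp_or P Q : dp P -> dp Q -> dp (fun e => P e \/ Q e).
Proof.
move=> dP dQ; apply: (dp_ext _ (dp_not (dp_and (dp_not dP) (dp_not dQ)))) => e.
by split=> [/not_andP[]/contrapT|[?[]//|?[]//]]; [left|right].
Qed.

Definition consenv (a : M) (e : env) : env := fun i => if i is j.+1 then e j else a.

Lemma dp_ex1 P : dp P -> dp (fun e => exists a, P (consenv a e)).
Proof.
move=> /dp_ge[k /(_ _ (leqnSn k))[phi H]]; exists k, (FEx phi) => e /=.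
have E a : [tuple of a :: pre k e] = pre k.+1 (consenv a e).
  apply: eq_from_tnth => i; rewrite (tnth_pre, tnth_mktuple).
  by case: (unliftP ord0 i) => [j|] ->; rewrite ?tnthS ?(tnth_pre, tnth_mktuple) ?tnth0.
split=> -[a Ha]; exists a; first by rewrite E; apply: (H _).1.
by apply: (H _).2; rewrite -E.
Qed.

Definition catenv n (y : n.-tuple M) (e : env) : env :=
  fun i => nth (e (i - n)%N) y i.

Lemma dp_exn n P : dp P -> dp (fun e => exists y : n.-tuple M, P (catenv y e)).
Proof.
elim: n P => [|n IH] P dP.
  apply: dp_ext dP => e.
  have E (y : 0.-tuple M) : catenv y e = e.
    by apply/funext => i; rewrite /catenv tuple0 nth_default ?subn0.
  by split=> [H|[y]]; [exists [tuple] |]; rewrite E.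
apply: dp_ext (IH _ (dp_ex1 dP)) => e.
have E a (y : n.-tuple M) : catenv [tuple of a :: y] e = consenv a (catenv y e).
  by apply/funext => -[|i].
split=> [[y [a H]]|[y]]; first by exists [tuple of a :: y]; rewrite E.
by case/tupleP: y => a y; rewrite E; exists y, a.
Qed.

Lemma pre_catenv n (y : n.-tuple M) e : pre n (catenv y e) = y.
Proof.
apply: eq_from_tnth => i; rewrite (tnth_pre, tnth_mktuple) /catenv.
by rewrite (tnth_nth (e (i - n)%N)).
Qed.

Lemma shift_catenv n (y : n.-tuple M) e : shift n (catenv y e) = e.
Proof.
apply/funext => i; rewrite /shift /catenv nth_default ?size_tuple ?leq_addr //.
by rewrite addKn.
Qed.

Lemma dp_ex n (Q : n.-tuple M -> env -> Prop) :
  dp (fun e => Q (pre n e) (shift n e)) -> dp (fun e => exists y, Q y e).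
Proof.
by move/(@dp_exn n); apply: dp_ext => e; split=> -[y];
  rewrite ?pre_catenv ?shift_catenv => H; exists y;
  rewrite ?pre_catenv ?shift_catenv.
Qed.

Definition simple n (t : env -> n.-tuple M) : Prop := forall i,
  (exists j, forall e, tnth (t e) i = e j) \/ (exists a, forall e, tnth (t e) i = a).

Lemma simple_pre n : simple (pre n).
Proof. by move=> i; left; exists i => e; rewrite (tnth_pre, tnth_mktuple). Qed.

Lemma simple_pre_of n (s : env -> env) :
  (forall i, exists j, forall e, s e i = e j) -> simple (fun e => pre n (s e)).
Proof.
by move=> H i; have [j E] := H i; left; exists j => e; rewrite tnth_pre E.
Qed.

Lemma simple_cst n (t : n.-tuple M) : simple (fun=> t).
Proof. by move=> i; right; exists (tnth t i). Qed.

Lemma tnth_catl T n m (x : n.-tuple T) (y : m.-tuple T) i :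
  tnth (cat_tuple x y) (lshift m i) = tnth x i.
Proof. exact: tnth_lshift. Qed.

Lemma tnth_catr T n m (x : n.-tuple T) (y : m.-tuple T) i :
  tnth (cat_tuple x y) (rshift n i) = tnth y i.
Proof. exact: tnth_rshift. Qed.

Lemma simple_cat n m (t : env -> n.-tuple M) (u : env -> m.-tuple M) :
  simple t -> simple u -> simple (fun e => cat_tuple (t e) (u e)).
Proof.
move=> st su i; case: (split_ordP i) => j ->.
  by case: (st j) => -[x H]; [left|right]; exists x => e; rewrite tnth_catl.
by case: (su j) => -[x H]; [left|right]; exists x => e; rewrite tnth_catr.
Qed.

Lemma simple_inl (a : M) n m (t : env -> n.-tuple M) :
  simple t -> simple (fun e => inj_left a m (t e)).
Proof. by move=> st; apply: simple_cat => //; apply: simple_cst. Qed.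

Lemma simple_inr (a b : M) n m (t : env -> m.-tuple M) :
  simple t -> simple (fun e => inj_right a b n (t e)).
Proof.
move=> st; apply: simple_cat; first exact: simple_cst.
by apply: simple_cat => //; apply: simple_cst.
Qed.

Lemma dp_set n (A : set (n.-tuple M)) t : definable A -> simple t ->
  dp (fun e => A (t e)).
Proof.
move=> [phi ->] st.
have {}st i : exists J, forall k, (J <= k)%N ->
    exists s : term k, forall e, tnth (t e) i = eval (pre k e) s.
  case: (st i) => [[j H]|[a H]]; last by exists 0%N => k _; exists (Par a).
  exists j.+1 => k jk; exists (Var M (Ordinal jk)) => e /=.
  by rewrite H (tnth_pre, tnth_mktuple).
have {st}[J HJ] := choice st.
pose k := \max_i J i.
have {HJ}[s Hs] := choice (fun i => HJ i k (leq_bigmax i)).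
exists k, (fsubst phi s) => e; rewrite holds_fsubst /=.
suff -> : t e = [tuple eval (pre k e) (s i) | i < n] by [].
by apply: eq_from_tnth => i; rewrite (tnth_pre, tnth_mktuple) Hs.
Qed.

Lemma dp_definable n (A : set (n.-tuple M)) :
  dp (fun e => A (pre n e)) -> definable A.
Proof.
move=> [k [phi H]]; have [a0] := carrier_inhabited M.
pose s (i : 'I_k) : term n := if insub (i : nat) is Some j then Var M j else Par a0.
exists (fsubst phi s); apply/seteqP.
suff E x : A x <-> holds (fsubst phi s) x by split=> x /E.
pose e i := nth a0 x i.
have xe : pre n e = x by apply: eq_from_tnth => i; rewrite (tnth_pre, tnth_mktuple) (tnth_nth a0).
rewrite -[X in A X]xe H holds_fsubst.
suff -> : pre k e = [tuple eval x (s i) | i < k] by [].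
apply: eq_from_tnth => i; rewrite !(tnth_pre, tnth_mktuple) /s /e.
case: insubP => [j _ <-|]; first by rewrite /= (tnth_nth a0).
by rewrite -leqNgt => ni; rewrite nth_default ?size_tuple.
Qed.

Lemma definable_eq1 : definable [set z : 2.-tuple M | tnth z ord0 = tnth z ord_max].
Proof. by exists (FEq (Var M ord0) (Var M ord_max)). Qed.

Lemma dp_true : dp (fun=> True).
Proof.
by exists 1%N, (FEq (Var M ord0) (Var M ord0)).
Qed.

Lemma dp_forall n (P : 'I_n -> env -> Prop) :
  (forall i, dp (P i)) -> dp (fun e => forall i, P i e).
Proof.
elim: n P => [|n IH] P dP; first by apply: dp_ext dp_true => e; split=> // _ [].
apply: dp_ext (dp_and (dP ord0) (IH (fun i => P (lift ord0 i)) _)) => // e.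
split=> [[H0 H] i|H //]; by case: (unliftP ord0 i) => [j|] ->.
Qed.

Lemma dp_eq n (t u : env -> n.-tuple M) : simple t -> simple u ->
  dp (fun e => t e = u e).
Proof.
move=> st su.
apply: (@dp_ext (fun e => forall i, tnth (t e) i = tnth (u e) i)).
  by move=> e; split=> [/eq_from_tnth|->].
apply: dp_forall => i.
apply: (@dp_ext (fun e => [set z : 2.-tuple M | tnth z ord0 = tnth z ord_max]
   [tuple tnth (t e) i; tnth (u e) i])).
  by move=> e.
apply: dp_set definable_eq1 _ => j.
case: (unliftP ord0 j) => [l|] ->; last by apply: (st i).
rewrite (ord1 l); apply: (su i).
Qed.

End Definability.

Ltac simple_tac := lazymatch goal with
  | |- simple (fun e => pre _ (@?s e)) =>
      apply: simple_pre_of => ?; eexists => ?; reflexivity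
  | |- simple (fun e => cat_tuple (@?t e) (@?u e)) =>
      apply: (@simple_cat _ _ _ _ t u); simple_tac
  | |- simple (fun e => inj_left _ _ (@?t e)) =>
      apply: (@simple_inl _ _ _ _ _ t); simple_tac
  | |- simple (fun e => inj_right _ _ _ (@?t e)) =>
      apply: (@simple_inr _ _ _ _ _ _ t); simple_tac
  | |- simple (pre _) => exact: simple_pre
  | |- simple _ => first [exact: simple_cst | progress cbn [fst snd]; simple_tac]
  | |- _ => idtac
  end.

Section DefinableBijections.
Variables (L : signature) (M : structure L).

Lemma cat_tupleI T n m (x x' : n.-tuple T) (y y' : m.-tuple T) :
  cat_tuple x y = cat_tuple x' y' -> x = x' /\ y = y'.
Proof.
move=> E; split; apply: eq_from_tnth => i.
  by rewrite -(tnth_catl x y) E tnth_catl.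
by rewrite -(tnth_catr x y) E tnth_catr.
Qed.

Lemma pre_cat n m (e : nat -> M) : pre (n + m) e = cat_tuple (pre n e) (pre m (shift n e)).
Proof.
apply: eq_from_tnth => i; case: (split_ordP i) => j ->.
  by rewrite tnth_catl !(tnth_pre, tnth_mktuple).
by rewrite tnth_catr !(tnth_pre, tnth_mktuple).
Qed.

Definition graph_definable n m (G : n.-tuple M -> m.-tuple M -> Prop) :=
  dp (fun e => G (pre n e) (pre m (shift n e))).

Lemma graph_definableP n m (G : n.-tuple M -> m.-tuple M -> Prop) :
  graph_definable G <->
  definable [set z | exists x y, z = cat_tuple x y /\ G x y].
Proof.
split=> [dG|dG].
  apply: dp_definable; apply: dp_ext dG => e /=; rewrite pre_cat.
  split=> [H|[x [y [/cat_tupleI[-> ->]]]]//].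
  by exists (pre n e), (pre m (shift n e)).
have := dp_set dG (@simple_pre _ M (n + m)); apply: dp_ext => e /=.
rewrite pre_cat; split=> [[x [y [/cat_tupleI[-> ->]]]]//|H].
by exists (pre n e), (pre m (shift n e)).
Qed.

Lemma dp_graph n m (G : n.-tuple M -> m.-tuple M -> Prop) t u :
  graph_definable G -> simple t -> simple u -> dp (fun e => G (t e) (u e)).
Proof.
move=> /graph_definableP dG st su.
apply: dp_ext (dp_set dG (simple_cat st su)) => e /=.
by split=> [[x [y [/cat_tupleI[-> ->]]]]//|H]; exists (t e), (u e).
Qed.

Lemma def_bijP n m (A : set (n.-tuple M)) (B : set (m.-tuple M)) :
  definably_bijective A B <->
  exists G : n.-tuple M -> m.-tuple M -> Prop, [/\ graph_definable G,
    forall x y, G x y -> A x /\ B y,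
    (forall x, A x -> exists y, G x y) /\ (forall y, B y -> exists x, G x y),
    forall x y y', G x y -> G x y' -> y = y' &
    forall x x' y, G x y -> G x' y -> x = x'].
Proof.
split=> [[f [[fAB finj fsurj] dG]]|[G [dG GAB [Gl Gr] Gf Gi]]].
  exists (fun x y => A x /\ y = f x); split.
  - apply/graph_definableP.
    suff -> : [set z | exists x y, z = cat_tuple x y /\ A x /\ y = f x] =
       [set cat_tuple x (f x) | x in A] by [].
    apply/seteqP; split=> [z [x [y [-> [Ax ->]]]]|z [x Ax <-]]; first by exists x.
    by exists x, (f x).
  - by move=> x y [Ax ->]; split => //; apply: fAB.
  - split=> [x Ax|y /fsurj[x Ax <-]]; first by exists (f x).
    by exists x.
  - by move=> x y y' [_ ->] [_ ->].
  - by move=> x x' y [Ax ->] [Ax' /finj]; apply; rewrite inE.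
have [a0] := carrier_inhabited M.
have /choice[f Hf] x : exists y, A x -> G x y.
  have [/Gl[y H]|nA] := pselect (A x); first by exists y.
  by exists (nseq_tuple m a0).
exists f; split.
  split=> [x Ax|x x'|y By].
  - by have [] := GAB _ _ (Hf _ Ax).
  - rewrite !inE => /Hf H /Hf H' E; apply: Gi H _; by rewrite E.
  - have [x Gxy] := Gr _ By; have [Ax _] := GAB _ _ Gxy; exists x => //.
    exact: Gf (Hf _ Ax) Gxy.
move/graph_definableP: dG.
suff -> : [set z | exists x y, z = cat_tuple x y /\ G x y] =
   [set cat_tuple x (f x) | x in A] by [].
apply/seteqP; split=> [z [x [y [-> H]]]|z [x Ax <-]].
  have [Ax _] := GAB _ _ H; exists x => //; congr cat_tuple.
  exact: Gf (Hf _ Ax) H.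
by exists x, (f x); split=> //; apply: Hf.
Qed.

(** Two sets with injective parametrizations by the same index set. *)
Lemma def_bij_param n m (A : set (n.-tuple M)) (B : set (m.-tuple M))
    (I : Type) (P : I -> Prop) (p : I -> n.-tuple M) (q : I -> m.-tuple M) :
  (forall x, A x <-> exists i, P i /\ x = p i) ->
  (forall y, B y <-> exists i, P i /\ y = q i) ->
  (forall i j, P i -> P j -> p i = p j -> i = j) ->
  (forall i j, P i -> P j -> q i = q j -> i = j) ->
  graph_definable (fun x y => exists i, P i /\ x = p i /\ y = q i) ->
  definably_bijective A B.
Proof.
move=> HA HB pI qI dG; apply/def_bijP.
exists (fun x y => exists i, P i /\ x = p i /\ y = q i); split=> //.
- by move=> x y [i [Pi [-> ->]]]; split; [apply/HA|apply/HB]; exists i.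
- split=> [x /HA[i [Pi ->]]|y /HB[i [Pi ->]]]; first by exists (q i), i.
  by exists (p i), i.
- by move=> x y y' [i [Pi [-> ->]]] [j [Pj [/pI-> // ->]]].
- by move=> x x' y [i [Pi [-> ->]]] [j [Pj [-> /qI->]]].
Qed.

Lemma dp_ex_sum (I J : Type) (Q : I + J -> (nat -> M) -> Prop) :
  dp (fun e => exists i, Q (inl i) e) -> dp (fun e => exists j, Q (inr j) e) ->
  dp (fun e => exists s, Q s e).
Proof.
move=> dI dJ; apply: dp_ext (dp_or dI dJ) => e.
by split=> [[[i H]|[i H]]|[[i|j] H]];
  [exists (inl i)|exists (inr i)|left; exists i|right; exists j].
Qed.

Lemma dp_ex_pair (I J : Type) (Q : I * J -> (nat -> M) -> Prop) :
  dp (fun e => exists i j, Q (i, j) e) -> dp (fun e => exists s, Q s e).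
Proof.
by apply: dp_ext => e; split=> [[i [j H]]|[[i j] H]]; [exists (i, j)|exists i, j].
Qed.

Lemma def_bij_refl n (A : set (n.-tuple M)) : definable A -> definably_bijective A A.
Proof.
move=> dA; apply: (@def_bij_param _ _ _ _ (n.-tuple M) A id id) => //.
- by move=> x; split=> [Ax|[y [Ay ->]]//]; exists x.
- by move=> x; split=> [Ax|[y [Ay ->]]//]; exists x.
apply: dp_ex; apply: dp_and; first by apply: dp_set; simple_tac.
by apply: dp_and; apply: dp_eq; simple_tac.
Qed.

Lemma def_bij_sym n m (A : set (n.-tuple M)) (B : set (m.-tuple M)) :
  definably_bijective A B -> definably_bijective B A.
Proof.
move=> /def_bijP[G [dG GAB [Gl Gr] Gf Gi]]; apply/def_bijP.
exists (fun y x => G x y); split=> //.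
- by apply: (dp_graph dG (t := fun e => pre n (shift m e)) (u := pre m));
    simple_tac.
- by move=> y x /GAB[].
- by move=> y x x'; apply: Gi.
- by move=> y y' x; apply: Gf.
Qed.

Lemma def_bij_trans n m k (A : set (n.-tuple M)) (B : set (m.-tuple M))
    (C : set (k.-tuple M)) :
  definably_bijective A B -> definably_bijective B C -> definably_bijective A C.
Proof.
move=> /def_bijP[G [dG GAB [Gl Gr] Gf Gi]] /def_bijP[H [dH HBC [Hl Hr] Hf Hi]].
apply/def_bijP; exists (fun x z => exists y, G x y /\ H y z); split.
- by apply: dp_ex; apply: dp_and; [apply: (dp_graph dG)|apply: (dp_graph dH)];
    simple_tac.
- by move=> x z [y [/GAB[? _] /HBC[_ ?]]].
- split=> [x /Gl[y Gxy]|z /Hr[y Hyz]].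
    have [_ /Hl[z Hyz]] := GAB _ _ Gxy; by exists z, y.
  have [/Gr[x Gxy] _] := HBC _ _ Hyz; by exists x, y.
- move=> x z z' [y [Gxy Hyz]] [y' [Gxy' Hyz']].
  by rewrite -(Gf _ _ _ Gxy Gxy') in Hyz'; apply: Hf Hyz Hyz'.
- move=> x x' z [y [Gxy Hyz]] [y' [Gxy' Hyz']].
  by rewrite -(Hi _ _ _ Hyz Hyz') in Gxy'; apply: Gi Gxy Gxy'.
Qed.

Lemma definable_prod n m (A : set (n.-tuple M)) (B : set (m.-tuple M)) :
  definable A -> definable B -> definable (setprod_tuple A B).
Proof.
move=> dA dB; apply: dp_definable.
apply: (@dp_ext _ _ (fun e => A (pre n e) /\ B (pre m (shift n e)))).
  move=> e; rewrite pre_cat; split=> [[Ax By]|[x Ax [y By /cat_tupleI[<- <-]]]//].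
  by exists (pre n e) => //; exists (pre m (shift n e)).
by apply: dp_and; apply: dp_set; simple_tac.
Qed.

Lemma def_bij_prod n m n' m' (A : set (n.-tuple M)) (B : set (m.-tuple M))
    (A' : set (n'.-tuple M)) (B' : set (m'.-tuple M)) :
  definably_bijective A A' -> definably_bijective B B' ->
  definably_bijective (setprod_tuple A B) (setprod_tuple A' B').
Proof.
move=> /def_bijP[G [dG GAB [Gl Gr] Gf Gi]] /def_bijP[H [dH HBC [Hl Hr] Hf Hi]].
apply/def_bijP; exists (fun z w => exists x y x' y',
  (G x x' /\ H y y') /\ (z = cat_tuple x y /\ w = cat_tuple x' y')); split.
- do 4!apply: dp_ex; apply: dp_and; apply: dp_and;
    [apply: (dp_graph dG)|apply: (dp_graph dH)|apply: dp_eq|apply: dp_eq]; simple_tac.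
- move=> z w [x [y [x' [y' [[/GAB[Ax A'x] /HBC[By B'y]] [-> ->]]]]]].
  by split; [exists x => //; exists y|exists x' => //; exists y'].
- split=> [z [x /Gl[x' Gx] [y /Hl[y' Hy] <-]]|z [x' /Gr[x Gx] [y' /Hr[y Hy] <-]]].
    by exists (cat_tuple x' y'), x, y, x', y'.
  by exists (cat_tuple x y), x, y, x', y'.
- move=> z w w' [x [y [x' [y' [[Gx Hy] [-> ->]]]]]].
  move=> [x1 [y1 [x1' [y1' [[Gx1 Hy1] [/cat_tupleI[E F] ->]]]]]]; subst.
  by rewrite (Gf _ _ _ Gx Gx1) (Hf _ _ _ Hy Hy1).
- move=> z z' w [x [y [x' [y' [[Gx Hy] [-> ->]]]]]].
  move=> [x1 [y1 [x1' [y1' [[Gx1 Hy1] [-> /cat_tupleI[E F]]]]]]]; subst.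
  by rewrite (Gi _ _ _ Gx Gx1) (Hi _ _ _ Hy Hy1).
Qed.

Variables (a b : M) (neq_ab : a <> b).

Local Notation inl_ := (inj_left a).
Local Notation inr_ := (inj_right a b).

Lemma inlI n m (x x' : n.-tuple M) : inl_ m x = inl_ m x' -> x = x'.
Proof. by case/cat_tupleI. Qed.

Lemma inrI n m (x x' : m.-tuple M) : inr_ n x = inr_ n x' -> x = x'.
Proof. by case/cat_tupleI => _ /cat_tupleI[]. Qed.

Lemma inlr n m (x : n.-tuple M) (y : m.-tuple M) : inl_ m x = inr_ n y -> False.
Proof.
case/cat_tupleI => _ /cat_tupleI[_ /(congr1 (fun z : 1.-tuple M => tnth z ord0))].
by rewrite !tnth0.
Qed.

Lemma definable_sum n m (A : set (n.-tuple M)) (B : set (m.-tuple M)) :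
  definable A -> definable B -> definable (setsum_tuple a b A B).
Proof.
move=> dA dB; apply: dp_definable; apply: (@dp_ext _ _ (fun e =>
  (exists x, A x /\ inl_ m x = pre _ e) \/ (exists y, B y /\ inr_ n y = pre _ e))).
  move=> e; split=> [[[x [Ax E]]|[y [By E]]]|[[x Ax E]|[y By E]]].
  - by left; exists x.
  - by right; exists y.
  - by left; exists x.
  - by right; exists y.
by apply: dp_or; apply: dp_ex; apply: dp_and; (apply: dp_set || apply: dp_eq);
   simple_tac.
Qed.

Lemma def_bij_sum n m n' m' (A : set (n.-tuple M)) (B : set (m.-tuple M))
    (A' : set (n'.-tuple M)) (B' : set (m'.-tuple M)) :
  definably_bijective A A' -> definably_bijective B B' ->
  definably_bijective (setsum_tuple a b A B) (setsum_tuple a b A' B').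
Proof.
move=> /def_bijP[G [dG GAB [Gl Gr] Gf Gi]] /def_bijP[H [dH HBC [Hl Hr] Hf Hi]].
apply/def_bijP; exists (fun z w =>
  (exists x x', G x x' /\ (z = inl_ m x /\ w = inl_ m' x')) \/
  (exists y y', H y y' /\ (z = inr_ n y /\ w = inr_ n' y'))); split.
- by apply: dp_or; do 2!apply: dp_ex; (apply: dp_and; first by (apply: (dp_graph dG) || apply: (dp_graph dH)); simple_tac);
    apply: dp_and; apply: dp_eq; simple_tac.
- move=> z w [[x [x' [/GAB[Ax A'x] [-> ->]]]]|[y [y' [/HBC[By B'y] [-> ->]]]]].
    by split; left; [exists x|exists x'].
  by split; right; [exists y|exists y'].
- split=> z [[x]|[y]].
  + by move=> /Gl[x' Gx] <-; exists (inl_ m' x'); left; exists x, x'.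
  + by move=> /Hl[y' Hy] <-; exists (inr_ n' y'); right; exists y, y'.
  + by move=> /Gr[x' Gx] <-; exists (inl_ m x'); left; exists x', x.
  + by move=> /Hr[y' Hy] <-; exists (inr_ n y'); right; exists y', y.
- move=> z w w' [[x [x' [Gx [-> ->]]]]|[y [y' [Hy [-> ->]]]]]
    [[x1 [x1' [Gx1 [E ->]]]]|[y1 [y1' [Hy1 [E ->]]]]].
  + by move/inlI: E => E; subst; rewrite (Gf _ _ _ Gx Gx1).
  + by case: (inlr E).
  + by case: (inlr (esym E)).
  + by move/inrI: E => E; subst; rewrite (Hf _ _ _ Hy Hy1).
- move=> z z' w [[x [x' [Gx [-> ->]]]]|[y [y' [Hy [-> ->]]]]]
    [[x1 [x1' [Gx1 [-> E]]]]|[y1 [y1' [Hy1 [-> E]]]]].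
  + by move/inlI: E => E; subst; rewrite (Gi _ _ _ Gx Gx1).
  + by case: (inlr E).
  + by case: (inlr (esym E)).
  + by move/inrI: E => E; subst; rewrite (Hi _ _ _ Hy Hy1).
Qed.

(** The sum does not depend on the choice of disjoint representatives. *)
Lemma def_bij_setU n (A B : set (n.-tuple M)) :
  definable A -> definable B -> A `&` B = set0 ->
  definably_bijective (A `|` B) (setsum_tuple a b A B).
Proof.
move=> dA dB AB0.
have AB x : A x -> B x -> False by move=> Ax Bx; have : (A `&` B) x by []; rewrite AB0.
apply: (@def_bij_param _ _ _ _ (n.-tuple M + n.-tuple M)
  (fun s => match s with inl x => A x | inr y => B y end)
  (fun s => match s with inl x => x | inr y => y end)
  (fun s => match s with inl x => inl_ n x | inr y => inr_ n y end)).
- move=> x; split=> [[?|?]|[[y|y] [? ->]]]; [|by exists (inr x)|by left|by right].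
  by exists (inl x).
- move=> x; split=> [[[y ? <-]|[y ? <-]]|[[y|y] [? ->]]].
  + by exists (inl y).
  + by exists (inr y).
  + by left; exists y.
  + by right; exists y.
- move=> [x|x] [y|y] Px Py E; subst => //; case: (AB y) => //.
- by move=> [x|x] [y|y] Px Py E;
    [rewrite (inlI E)|case: (inlr E)|case: (inlr (esym E))|rewrite (inrI E)].
by apply: dp_ex_sum; apply: dp_ex; (apply: dp_and; first by apply: dp_set; simple_tac);
  apply: dp_and; apply: dp_eq; simple_tac.
Qed.

Lemma def_bij_sumC n m (A : set (n.-tuple M)) (B : set (m.-tuple M)) :
  definable A -> definable B ->
  definably_bijective (setsum_tuple a b A B) (setsum_tuple a b B A).
Proof.
move=> dA dB; apply: (@def_bij_param _ _ _ _ (n.-tuple M + m.-tuple M)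
  (fun s => match s with inl x => A x | inr y => B y end)
  (fun s => match s with inl x => inl_ m x | inr y => inr_ n y end)
  (fun s => match s with inl x => inr_ m x | inr y => inl_ n y end)).
- move=> x; split=> [[[y ? <-]|[y ? <-]]|[[y|y] [? ->]]].
  + by exists (inl y).
  + by exists (inr y).
  + by left; exists y.
  + by right; exists y.
- move=> x; split=> [[[y ? <-]|[y ? <-]]|[[y|y] [? ->]]].
  + by exists (inr y).
  + by exists (inl y).
  + by right; exists y.
  + by left; exists y.
- by move=> [x|x] [y|y] Px Py E;
    [rewrite (inlI E)|case: (inlr E)|case: (inlr (esym E))|rewrite (inrI E)].
- by move=> [x|x] [y|y] Px Py E;
    [rewrite (inrI E)|case: (inlr (esym E))|case: (inlr E)|rewrite (inlI E)].
by apply: dp_ex_sum; apply: dp_ex; (apply: dp_and; first by apply: dp_set; simple_tac);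
  apply: dp_and; apply: dp_eq; simple_tac.
Qed.

Lemma def_bij_sumA n m k (A : set (n.-tuple M)) (B : set (m.-tuple M))
    (C : set (k.-tuple M)) : definable A -> definable B -> definable C ->
  definably_bijective (setsum_tuple a b A (setsum_tuple a b B C))
    (setsum_tuple a b (setsum_tuple a b A B) C).
Proof.
move=> dA dB dC.
apply: (@def_bij_param _ _ _ _ (n.-tuple M + (m.-tuple M + k.-tuple M))
  (fun s => match s with inl x => A x | inr (inl y) => B y | inr (inr z) => C z end)
  (fun s => match s with inl x => inl_ _ x | inr (inl y) => inr_ _ (inl_ _ y)
    | inr (inr z) => inr_ _ (inr_ _ z) end)
  (fun s => match s with inl x => inl_ _ (inl_ _ x)
    | inr (inl y) => inl_ _ (inr_ _ y) | inr (inr z) => inr_ _ z end)).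
- move=> x; split=> [[[y ? <-]|[_ [[y ? <-]|[y ? <-]] <-]]|[[y|[y|y]] [? ->]]].
  + by exists (inl y).
  + by exists (inr (inl y)).
  + by exists (inr (inr y)).
  + by left; exists y.
  + by right; exists (inl_ _ y) => //; left; exists y.
  + by right; exists (inr_ _ y) => //; right; exists y.
- move=> x; split=> [[[_ [[y ? <-]|[y ? <-]] <-]|[y ? <-]]|[[y|[y|y]] [? ->]]].
  + by exists (inl y).
  + by exists (inr (inl y)).
  + by exists (inr (inr y)).
  + by left; exists (inl_ _ y) => //; left; exists y.
  + by left; exists (inr_ _ y) => //; right; exists y.
  + by right; exists y.
- move=> [x|[x|x]] [y|[y|y]] Px Py E; try by case: (inlr E).
  + by rewrite (inlI E).
  + by case: (inlr (esym E)).
  + by rewrite (inlI (inrI E)).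
  + by case: (inlr (inrI E)).
  + by case: (inlr (esym E)).
  + by case: (inlr (esym (inrI E))).
  + by rewrite (inrI (inrI E)).
- move=> [x|[x|x]] [y|[y|y]] Px Py E; try by case: (inlr E).
  + by rewrite (inlI (inlI E)).
  + by case: (inlr (inlI E)).
  + by case: (inlr (esym (inlI E))).
  + by rewrite (inrI (inlI E)).
  + by case: (inlr (esym E)).
  + by case: (inlr (esym E)).
  + by rewrite (inrI E).
apply: dp_ex_sum; last apply: dp_ex_sum; apply: dp_ex;
  (apply: dp_and; first by apply: dp_set; simple_tac);
  apply: dp_and; apply: dp_eq; simple_tac.
Qed.

Lemma definable0 n : definable (@set0 (n.-tuple M)).
Proof.
apply: dp_definable; apply: dp_ext (dp_not (dp_true M)) => e.
by split=> // -[].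
Qed.

Lemma definableT n : definable [set: n.-tuple M].
Proof. by apply: dp_definable; apply: dp_ext (dp_true M). Qed.

Lemma def_bij_sum0 n m (B : set (m.-tuple M)) : definable B ->
  definably_bijective (setsum_tuple a b (@set0 (n.-tuple M)) B) B.
Proof.
move=> dB; apply: (@def_bij_param _ _ _ _ (m.-tuple M) B (inr_ n) id) => //.
- by move=> x; split=> [[[]//|[y ? <-]]|[y [? ->]]]; [exists y|right; exists y].
- by move=> x; split=> [?|[y [? ->]]//]; exists x.
- by move=> x y _ _ /inrI.
apply: dp_ex; apply: dp_and; first by apply: dp_set; simple_tac.
by apply: dp_and; apply: dp_eq; simple_tac.
Qed.

Lemma def_bij_prod0 n m k (B : set (m.-tuple M)) :
  definably_bijective (setprod_tuple (@set0 (n.-tuple M)) B) (@set0 (k.-tuple M)).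
Proof.
apply/def_bijP; exists (fun _ _ => False); split=> //.
  by apply: dp_ext (dp_not (dp_true M)) => e; split=> // -[].
by split=> [x [y []]|].
Qed.

Lemma def_bij_prod1 m (B : set (m.-tuple M)) : definable B ->
  definably_bijective (setprod_tuple [set: 0.-tuple M] B) B.
Proof.
move=> dB; apply: (@def_bij_param _ _ _ _ (m.-tuple M) B
  (fun y => cat_tuple [tuple] y) id) => //.
- move=> x; split=> [[u _ [y ? <-]]|[y [? ->]]].
    by exists y; rewrite (tuple0 u).
  by exists [tuple] => //; exists y.
- by move=> x; split=> [?|[y [? ->]]//]; exists x.
- by move=> x y _ _ /cat_tupleI[].
apply: dp_ex; apply: dp_and; first by apply: dp_set; simple_tac.
by apply: dp_and; apply: dp_eq; simple_tac.
Qed.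

Lemma def_bij_prodC n m (A : set (n.-tuple M)) (B : set (m.-tuple M)) :
  definable A -> definable B ->
  definably_bijective (setprod_tuple A B) (setprod_tuple B A).
Proof.
move=> dA dB; apply: (@def_bij_param _ _ _ _ (n.-tuple M * m.-tuple M)
  (fun s => A s.1 /\ B s.2) (fun s => cat_tuple s.1 s.2)
  (fun s => cat_tuple s.2 s.1)).
- move=> z; split=> [[x ? [y ? <-]]|[[x y] [[? ?] ->]]]; first by exists (x, y).
  by exists x => //; exists y.
- move=> z; split=> [[x ? [y ? <-]]|[[x y] [[? ?] ->]]]; first by exists (y, x).
  by exists y => //; exists x.
- by move=> [x y] [x' y'] _ _ /cat_tupleI[/= -> ->].
- by move=> [x y] [x' y'] _ _ /cat_tupleI[/= -> ->].
apply: dp_ex_pair; do 2!apply: dp_ex; apply: dp_and.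
  by apply: dp_and; apply: dp_set; simple_tac.
by apply: dp_and; apply: dp_eq; simple_tac.
Qed.

Lemma def_bij_prodA n m k (A : set (n.-tuple M)) (B : set (m.-tuple M))
    (C : set (k.-tuple M)) : definable A -> definable B -> definable C ->
  definably_bijective (setprod_tuple A (setprod_tuple B C))
    (setprod_tuple (setprod_tuple A B) C).
Proof.
move=> dA dB dC.
apply: (@def_bij_param _ _ _ _ (n.-tuple M * (m.-tuple M * k.-tuple M))
  (fun s => A s.1 /\ (B s.2.1 /\ C s.2.2))
  (fun s => cat_tuple s.1 (cat_tuple s.2.1 s.2.2))
  (fun s => cat_tuple (cat_tuple s.1 s.2.1) s.2.2)).
- move=> w; split=> [[x ? [_ [y ? [z ? <-]] <-]]|[[x [y z]] [[? [? ?]] ->]]].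
    by exists (x, (y, z)).
  by exists x => //; exists (cat_tuple y z) => //; exists y => //; exists z.
- move=> w; split=> [[_ [x ? [y ? <-]] [z ? <-]]|[[x [y z]] [[? [? ?]] ->]]].
    by exists (x, (y, z)).
  by exists (cat_tuple x y); [exists x => //; exists y|exists z].
- by move=> [x [y z]] [x' [y' z']] _ _ /cat_tupleI[/= -> /cat_tupleI[-> ->]].
- by move=> [x [y z]] [x' [y' z']] _ _ /cat_tupleI[/= /cat_tupleI[-> ->] ->].
apply: dp_ex_pair; apply: dp_ex; apply: dp_ex_pair; do 2!apply: dp_ex.
apply: dp_and; last by apply: dp_and; apply: dp_eq; simple_tac.
by apply: dp_and; last apply: dp_and; apply: dp_set; simple_tac.
Qed.

Lemma def_bij_prodDl n m k (A : set (n.-tuple M)) (B : set (m.-tuple M))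
    (C : set (k.-tuple M)) : definable A -> definable B -> definable C ->
  definably_bijective (setprod_tuple (setsum_tuple a b A B) C)
    (setsum_tuple a b (setprod_tuple A C) (setprod_tuple B C)).
Proof.
move=> dA dB dC.
apply: (@def_bij_param _ _ _ _
  ((n.-tuple M * k.-tuple M) + (m.-tuple M * k.-tuple M))
  (fun s => match s with inl x => A x.1 /\ C x.2 | inr y => B y.1 /\ C y.2 end)
  (fun s => match s with inl x => cat_tuple (inl_ _ x.1) x.2
     | inr y => cat_tuple (inr_ _ y.1) y.2 end)
  (fun s => match s with inl x => inl_ _ (cat_tuple x.1 x.2)
     | inr y => inr_ _ (cat_tuple y.1 y.2) end)).
- move=> w; split=> [[_ [[x ? <-]|[y ? <-]] [z ? <-]]|[[[x z]|[y z]] [[? ?] ->]]].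
  + by exists (inl (x, z)).
  + by exists (inr (y, z)).
  + by exists (inl_ _ x); [left; exists x|exists z].
  + by exists (inr_ _ y); [right; exists y|exists z].
- move=> w; split=> [[[_ [x ? [z ? <-]] <-]|[_ [x ? [z ? <-]] <-]]
      |[[[x z]|[y z]] [[? ?] ->]]].
  + by exists (inl (x, z)).
  + by exists (inr (x, z)).
  + by left; exists (cat_tuple x z) => //; exists x => //; exists z.
  + by right; exists (cat_tuple y z) => //; exists y => //; exists z.
- move=> [[x z]|[x z]] [[x' z']|[x' z']] _ _ /cat_tupleI[/= E ->].
  + by rewrite (inlI E).
  + by case: (inlr E).
  + by case: (inlr (esym E)).
  + by rewrite (inrI E).
- move=> [[x z]|[x z]] [[x' z']|[x' z']] _ _ E.
  + by case: (cat_tupleI (inlI E)) => /= -> ->.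
  + by case: (inlr E).
  + by case: (inlr (esym E)).
  + by case: (cat_tupleI (inrI E)) => /= -> ->.
apply: dp_ex_sum; apply: dp_ex_pair; do 2!apply: dp_ex;
  (apply: dp_and; first by apply: dp_and; apply: dp_set; simple_tac);
  by apply: dp_and; apply: dp_eq; simple_tac.
Qed.

End DefinableBijections.

(** Two definable subsets of powers of [M] have disjoint representatives, as
    needed for the sum of their classes, when [M] has two distinct elements;
    over a one-element structure the sum of two points would not exist. *)
Definition nontrivial (L : signature) (M : structure L) : Prop :=
  exists a b : M, a <> b.

Section DefSemiring.
Variables (L : signature) (M : structure L) (hM : nontrivial M).

HB.instance Definition _ := gen_eqMixin (dset M).
HB.instance Definition _ := gen_choiceMixin (dset M).

Definition dset_eqv (A B : dset M) : bool := `[< definably_bijective A B >].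

Lemma dset_eqv_refl : reflexive dset_eqv.
Proof. by move=> A; apply/asboolP/def_bij_refl/points_definable. Qed.

Lemma dset_eqv_sym : symmetric dset_eqv.
Proof. by move=> A B; apply/asboolP/asboolP; apply: def_bij_sym. Qed.

Lemma dset_eqv_trans : transitive dset_eqv.
Proof.
move=> B A C /asboolP AB /asboolP BC; apply/asboolP; exact: def_bij_trans AB BC.
Qed.

Canonical dset_equiv := EquivRel dset_eqv dset_eqv_refl dset_eqv_sym dset_eqv_trans.

Let a : M := sval (cid hM).
Let b : M := sval (cid (svalP (cid hM))).
Let neq_ab : a <> b := svalP (cid (svalP (cid hM))).

Definition dset0 : dset M := DSet (definable0 M 0).
Definition dset1 : dset M := DSet (definableT M 0).
Definition dset_add (A B : dset M) : dset M :=
  DSet (definable_sum a b (points_definable A) (points_definable B)).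
Definition dset_mul (A B : dset M) : dset M :=
  DSet (definable_prod (points_definable A) (points_definable B)).

Definition DefTilde of nontrivial M := {eq_quot dset_equiv}.
Local Notation D := (DefTilde hM).

HB.instance Definition _ := Choice.on D.
HB.instance Definition _ := EqQuotient.on D.

Definition dclass (A : dset M) : D := \pi_D A.

Lemma dclassP A B : dclass A = dclass B <-> definably_bijective A B.
Proof. by split=> [/eqquotP/asboolP|H]; last by apply/eqquotP/asboolP. Qed.

Lemma dclassK (X : D) : exists A, X = dclass A.
Proof. by exists (repr X); rewrite /dclass reprK. Qed.

Lemma repr_dclass A : definably_bijective (repr (dclass A)) A.
Proof. by apply/dclassP; rewrite /dclass reprK. Qed.

Definition DefTilde_add (X Y : D) : D := dclass (dset_add (repr X) (repr Y)).
Definition DefTilde_mul (X Y : D) : D := dclass (dset_mul (repr X) (repr Y)).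

Lemma dclass_add A B : DefTilde_add (dclass A) (dclass B) = dclass (dset_add A B).
Proof. by apply/dclassP/def_bij_sum; rewrite //; apply: repr_dclass. Qed.

Lemma dclass_mul A B : DefTilde_mul (dclass A) (dclass B) = dclass (dset_mul A B).
Proof. by apply/dclassP/def_bij_prod; apply: repr_dclass. Qed.

Hint Resolve points_definable : core.

Lemma DefTilde_addA : associative DefTilde_add.
Proof.
move=> X Y Z; have [A ->] := dclassK X; have [B ->] := dclassK Y.
have [C ->] := dclassK Z; rewrite !dclass_add; apply/dclassP; exact: def_bij_sumA.
Qed.

Lemma DefTilde_addC : commutative DefTilde_add.
Proof.
move=> X Y; have [A ->] := dclassK X; have [B ->] := dclassK Y.
rewrite !dclass_add; apply/dclassP; exact: def_bij_sumC.
Qed.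

Lemma DefTilde_add0 : left_id (dclass dset0) DefTilde_add.
Proof.
move=> X; have [A ->] := dclassK X.
rewrite !dclass_add; apply/dclassP; exact: def_bij_sum0.
Qed.

HB.instance Definition _ :=
  GRing.isNmodule.Build D DefTilde_addA DefTilde_addC DefTilde_add0.

Lemma DefTilde_mulA : associative DefTilde_mul.
Proof.
move=> X Y Z; have [A ->] := dclassK X; have [B ->] := dclassK Y.
have [C ->] := dclassK Z; rewrite !dclass_mul; apply/dclassP; exact: def_bij_prodA.
Qed.

Lemma DefTilde_mulC : commutative DefTilde_mul.
Proof.
move=> X Y; have [A ->] := dclassK X; have [B ->] := dclassK Y.
rewrite !dclass_mul; apply/dclassP; exact: def_bij_prodC.
Qed.

Lemma DefTilde_mul1 : left_id (dclass dset1) DefTilde_mul.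
Proof.
move=> X; have [A ->] := dclassK X.
rewrite !dclass_mul; apply/dclassP; exact: def_bij_prod1.
Qed.

Lemma DefTilde_mulDl : left_distributive DefTilde_mul DefTilde_add.
Proof.
move=> X Y Z; have [A ->] := dclassK X; have [B ->] := dclassK Y.
have [C ->] := dclassK Z; rewrite dclass_add !dclass_mul dclass_add.
apply/dclassP; exact: def_bij_prodDl.
Qed.

Lemma DefTilde_mul0 : left_zero (dclass dset0) DefTilde_mul.
Proof.
move=> X; have [A ->] := dclassK X.
rewrite !dclass_mul; apply/dclassP; exact: def_bij_prod0.
Qed.

HB.instance Definition _ := GRing.Nmodule_isComPzSemiRing.Build D
  DefTilde_mulA DefTilde_mulC DefTilde_mul1 DefTilde_mulDl DefTilde_mul0.

Lemma dclassU n (A B : set (n.-tuple M)) (dA : definable A) (dB : definable B)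
    (dAB : definable (A `|` B)) : A `&` B = set0 ->
  dclass (DSet dAB) = (dclass (DSet dA) + dclass (DSet dB))%R.
Proof.
move=> AB0; rewrite [RHS]dclass_add; apply/dclassP; exact: def_bij_setU.
Qed.

End DefSemiring.

Local Open Scope ring_scope.

Section Cancellative.
Variable S : comPzSemiRingType.
Implicit Types x y z : S.

Definition canc_rel x y : bool := `[< exists z, x + z = y + z >].

Lemma canc_refl : reflexive canc_rel.
Proof. by move=> x; apply/asboolP; exists 0. Qed.

Lemma canc_sym : symmetric canc_rel.
Proof. by move=> x y; apply/asboolP/asboolP => -[z E]; exists z. Qed.

Lemma canc_trans : transitive canc_rel.
Proof.
move=> y x z /asboolP[u E] /asboolP[v F]; apply/asboolP; exists (u + v).
by rewrite addrA E addrAC F addrAC -addrA.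
Qed.

Canonical canc_equiv := EquivRel canc_rel canc_refl canc_sym canc_trans.

Definition canc := {eq_quot canc_equiv}.

HB.instance Definition _ := Choice.on canc.
HB.instance Definition _ := EqQuotient.on canc.

Definition cclass x : canc := \pi_canc x.

Lemma cclassP x y : cclass x = cclass y <-> exists z, x + z = y + z.
Proof. by split=> [/eqquotP/asboolP|H]; last by apply/eqquotP/asboolP. Qed.

Lemma cclassK (u : canc) : exists x, u = cclass x.
Proof. by exists (repr u); rewrite /cclass reprK. Qed.

Lemma repr_cclass x : exists z, repr (cclass x) + z = x + z.
Proof. by apply/cclassP; rewrite /cclass reprK. Qed.

Definition canc_add (u v : canc) : canc := cclass (repr u + repr v).
Definition canc_mul (u v : canc) : canc := cclass (repr u * repr v).

Lemma cclass_add x y : canc_add (cclass x) (cclass y) = cclass (x + y).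
Proof.
apply/cclassP; have [u E] := repr_cclass x; have [v F] := repr_cclass y.
by exists (u + v); rewrite addrACA E F addrACA.
Qed.

Lemma cclass_mul x y : canc_mul (cclass x) (cclass y) = cclass (x * y).
Proof.
apply/cclassP; have [u E] := repr_cclass x; have [v F] := repr_cclass y.
move: (repr _) (repr _) E F => y' x' E F.
exists (u * y' + x * v).
by rewrite addrA -mulrDl E mulrDl addrAC -mulrDr F mulrDr addrAC addrA.
Qed.

Lemma canc_addA : associative canc_add.
Proof.
move=> u v w; have [x ->] := cclassK u; have [y ->] := cclassK v.
by have [z ->] := cclassK w; rewrite !cclass_add addrA.
Qed.

Lemma canc_addC : commutative canc_add.
Proof.
by move=> u v; have [x ->] := cclassK u; have [y ->] := cclassK v;
  rewrite !cclass_add addrC.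
Qed.

Lemma canc_add0 : left_id (cclass 0) canc_add.
Proof. by move=> u; have [x ->] := cclassK u; rewrite cclass_add add0r. Qed.

HB.instance Definition _ := GRing.isNmodule.Build canc canc_addA canc_addC canc_add0.

Lemma canc_mulA : associative canc_mul.
Proof.
move=> u v w; have [x ->] := cclassK u; have [y ->] := cclassK v.
by have [z ->] := cclassK w; rewrite !cclass_mul mulrA.
Qed.

Lemma canc_mulC : commutative canc_mul.
Proof.
by move=> u v; have [x ->] := cclassK u; have [y ->] := cclassK v;
  rewrite !cclass_mul mulrC.
Qed.

Lemma canc_mul1 : left_id (cclass 1) canc_mul.
Proof. by move=> u; have [x ->] := cclassK u; rewrite cclass_mul mul1r. Qed.

Lemma canc_mulDl : left_distributive canc_mul canc_add.
Proof.
move=> u v w; have [x ->] := cclassK u; have [y ->] := cclassK v.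
by have [z ->] := cclassK w; rewrite cclass_add !cclass_mul cclass_add mulrDl.
Qed.

Lemma canc_mul0 : left_zero (cclass 0) canc_mul.
Proof. by move=> u; have [x ->] := cclassK u; rewrite cclass_mul mul0r. Qed.

HB.instance Definition _ := GRing.Nmodule_isComPzSemiRing.Build canc
  canc_mulA canc_mulC canc_mul1 canc_mulDl canc_mul0.

Lemma canc_addIr (w u v : canc) : u + w = v + w -> u = v.
Proof.
have [x ->] := cclassK u; have [y ->] := cclassK v; have [z ->] := cclassK w.
rewrite [X in X = _ -> _]cclass_add [X in _ = X -> _]cclass_add => /cclassP[t E].
by apply/cclassP; exists (z + t); rewrite !addrA.
Qed.

End Cancellative.

Section FormalDifferences.
Variable S : comPzSemiRingType.
Local Notation C := (canc S).
Implicit Types p q r : C * C.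

(** The pair [(x, y)] stands for the formal difference [x - y]. *)
Definition diff_rel p q : bool := p.1 + q.2 == q.1 + p.2.

Lemma diff_refl : reflexive diff_rel.
Proof. by move=> p; apply/eqP. Qed.

Lemma diff_sym : symmetric diff_rel.
Proof. by move=> p q; apply/eqP/eqP => ->. Qed.

Lemma diff_trans : transitive diff_rel.
Proof.
move=> [y y'] [x x'] [z z'] /eqP /= E /eqP /= F; apply/eqP => /=.
apply: (@canc_addIr _ (y + y')).
rewrite [y + y']addrC [LHS]addrACA E [z' + y]addrC F [LHS]addrC.
by rewrite [y + x']addrC addrACA.
Qed.

Canonical diff_equiv := EquivRel diff_rel diff_refl diff_sym diff_trans.

Definition groth := {eq_quot diff_equiv}.

HB.instance Definition _ := Choice.on groth.
HB.instance Definition _ := EqQuotient.on groth.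

Definition gclass p : groth := \pi_groth p.

Lemma gclassP p q : gclass p = gclass q <-> p.1 + q.2 = q.1 + p.2.
Proof. by split=> [/eqquotP/eqP|H]; last by apply/eqquotP/eqP. Qed.

Lemma gclassK (u : groth) : exists p, u = gclass p.
Proof. by exists (repr u); rewrite /gclass reprK. Qed.

Lemma repr_gclass p : (repr (gclass p)).1 + p.2 = p.1 + (repr (gclass p)).2.
Proof. by apply/gclassP; rewrite /gclass reprK. Qed.

Definition diff_add p q := (p.1 + q.1, p.2 + q.2).
Definition diff_mul p q := (p.1 * q.1 + p.2 * q.2, p.1 * q.2 + p.2 * q.1).
Definition diff_opp p := (p.2, p.1).

Definition groth_add (u v : groth) : groth := gclass (diff_add (repr u) (repr v)).
Definition groth_mul (u v : groth) : groth := gclass (diff_mul (repr u) (repr v)).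
Definition groth_opp (u : groth) : groth := gclass (diff_opp (repr u)).

Lemma gclass_add p q : groth_add (gclass p) (gclass q) = gclass (diff_add p q).
Proof.
apply/gclassP; have E := repr_gclass p; have F := repr_gclass q.
by rewrite /= addrACA E F addrACA.
Qed.

Lemma gclass_opp p : groth_opp (gclass p) = gclass (diff_opp p).
Proof.
by apply/gclassP; have E := repr_gclass p; rewrite /= addrC -E addrC.
Qed.

Lemma gclass_mulr p q q' : gclass q = gclass q' ->
  gclass (diff_mul p q) = gclass (diff_mul p q').
Proof.
case: p q q' => [x x'] [y y'] [z z'] /gclassP /= E; apply/gclassP => /=.
rewrite [LHS]addrACA [RHS]addrACA -!mulrDr E.
by rewrite [y' + z]addrC [z' + y]addrC E.
Qed.

Lemma diff_mulC p q : diff_mul p q = diff_mul q p.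
Proof.
case: p q => [x x'] [y y']; rewrite /diff_mul /=.
by rewrite [x * y]mulrC [x' * y']mulrC [x * y']mulrC [x' * y]mulrC [X in (_, X)]addrC.
Qed.

Lemma gclass_mul p q : groth_mul (gclass p) (gclass q) = gclass (diff_mul p q).
Proof.
have E r : gclass (repr (gclass r)) = gclass r by rewrite /gclass reprK.
rewrite /groth_mul (gclass_mulr _ (E q)) diff_mulC [in RHS]diff_mulC.
exact: gclass_mulr (E p).
Qed.

Lemma groth_addA : associative groth_add.
Proof.
move=> u v w; have [p ->] := gclassK u; have [q ->] := gclassK v.
by have [r ->] := gclassK w; rewrite !gclass_add /diff_add /= !addrA.
Qed.

Lemma groth_addC : commutative groth_add.
Proof.
move=> u v; have [p ->] := gclassK u; have [q ->] := gclassK v.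
by rewrite !gclass_add /diff_add /= [p.1 + _]addrC [p.2 + _]addrC.
Qed.

Lemma groth_add0 : left_id (gclass (0, 0)) groth_add.
Proof.
by move=> u; have [p ->] := gclassK u; rewrite gclass_add /diff_add /= !add0r -surjective_pairing.
Qed.

Lemma groth_addN : left_inverse (gclass (0, 0)) groth_opp groth_add.
Proof.
move=> u; have [p ->] := gclassK u; rewrite gclass_opp gclass_add.
by apply/gclassP; rewrite /= addr0 add0r addrC.
Qed.

HB.instance Definition _ :=
  GRing.isZmodule.Build groth groth_addA groth_addC groth_add0 groth_addN.

Lemma groth_mulA : associative groth_mul.
Proof.
move=> u v w; have [p ->] := gclassK u; have [q ->] := gclassK v.
have [r ->] := gclassK w; rewrite !gclass_mul /diff_mul /=; congr (gclass (_, _)).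
  rewrite !mulrDr !mulrDl !mulrA -!addrA; congr (_ + _).
  by rewrite [LHS]addrA [RHS]addrC.
rewrite !mulrDr !mulrDl !mulrA -!addrA; congr (_ + _).
by rewrite [LHS]addrA [RHS]addrC.
Qed.

Lemma groth_mulC : commutative groth_mul.
Proof.
move=> u v; have [p ->] := gclassK u; have [q ->] := gclassK v.
by rewrite !gclass_mul diff_mulC.
Qed.

Lemma groth_mul1 : left_id (gclass (1, 0)) groth_mul.
Proof.
move=> u; have [p ->] := gclassK u; rewrite gclass_mul /diff_mul /=.
by rewrite !mul1r !mul0r !addr0 -surjective_pairing.
Qed.

Lemma groth_mulDl : left_distributive groth_mul groth_add.
Proof.
move=> u v w; have [p ->] := gclassK u; have [q ->] := gclassK v.
have [r ->] := gclassK w; rewrite gclass_add !gclass_mul gclass_add /diff_mul /diff_add /=.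
by rewrite !mulrDl; congr (gclass (_, _)); rewrite addrACA.
Qed.

HB.instance Definition _ := GRing.Zmodule_isComPzRing.Build groth
  groth_mulA groth_mulC groth_mul1 groth_mulDl.

End FormalDifferences.

Definition K0 (L : signature) (M : structure L) (hM : nontrivial M) : comPzRingType :=
  groth (DefTilde hM).

Definition zero_ring : Type := unit.

HB.instance Definition _ := Choice.on zero_ring.

Definition zero_ring_op (_ _ : zero_ring) : zero_ring := tt.

Lemma zero_ring_opA : associative zero_ring_op. Proof. by []. Qed.
Lemma zero_ring_opC : commutative zero_ring_op. Proof. by []. Qed.
Lemma zero_ring_id : left_id tt zero_ring_op. Proof. by case. Qed.
Lemma zero_ring_inv : left_inverse tt id zero_ring_op. Proof. by []. Qed.
Lemma zero_ring_dist : left_distributive zero_ring_op zero_ring_op. Proof. by []. Qed.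

HB.instance Definition _ := GRing.isZmodule.Build zero_ring
  zero_ring_opA zero_ring_opC zero_ring_id zero_ring_inv.
HB.instance Definition _ := GRing.Zmodule_isComPzRing.Build zero_ring
  zero_ring_opA zero_ring_opC zero_ring_id zero_ring_dist.

(** ['Z_1] is the ring with two elements, and [{poly R}] requires [R] to be
    nonzero, whereas the polynomials over [Z/1Z] form the zero ring. *)
Definition poly_Zmod (N : nat) : comPzRingType :=
  if N == 1%N then (zero_ring : comPzRingType) else ({poly 'Z_N} : comPzRingType).

(* Main.v *)
From HB Require Import structures.
Require Import Defs.
From mathcomp Require Import all_boot all_order all_algebra.
From mathcomp Require Import boolp classical_sets.
From mathcomp Require Import zify ring.

Set Implicit Arguments.
Unset Strict Implicit.
Unset Printing Implicit Defensive.

Import Order.TTheory GRing.Theory Num.Theory.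
Local Open Scope ring_scope.

(** The structure is [nat] with the relations [y = x + N * k]. The shift by [N]
    is a definable bijection of the line onto the complement of [N] points, so
    [N = 0] in [K0]; and a definable set is determined by finitely many
    equations between coordinates, so that, peeling off one coordinate at a
    time, its class is a polynomial in the class [X] of the line. To see that
    there is no further relation, let [R] be a commutative ring with [N = 0] and
    [x] in [R]. Functions of one variable in [R] that are eventually constant
    have an integral giving mass [1] to points and mass [x] to the line. For
    functions of several variables depending on finitely many equations between
    coordinates, iterated integrals commute: the only nontrivial case is the
    indicator function of [b = a + N * k], whose two iterated integrals differ by
    [N * k = 0]. By this Fubini theorem, applied to its graph, a definable
    bijection preserves the iterated integral of the indicator function, which
    therefore induces a ring morphism from [K0] to [R] that maps [X] to [x]. *)

(** * Integration on the line *)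

Section Integral.
Variables (R : comPzRingType) (x : R).
Implicit Types (u v : nat -> R) (c : R).

Definition evconst u := exists m c, forall a, (m <= a)%N -> u a = c.

(** Euler integral: points have mass [1] and the whole line has mass [x]; the
    value is [0] when [u] is not eventually constant. *)
Definition int1 u : R :=
  if pselect (evconst u) is left h then
    let m := projT1 (cid h) in \sum_(a < m) (u a - u m) + x * u m
  else 0.

(** Raising the threshold only adds zero terms to the sum, so every threshold beyond which the
    function is constant computes the same value. *)
Lemma int1E u m c : (forall a, (m <= a)%N -> u a = c) ->
  int1 u = \sum_(a < m) (u a - c) + x * c.
Proof.
move=> Hm; rewrite /int1; case: pselect => [h|[]]; last by exists m, c.
case: cid => m' [c' Hm'] /=.
have -> : u m' = c' by apply: Hm'.
have Ec : c' = c by rewrite -(Hm' (maxn m m')) ?leq_maxr // Hm ?leq_maxl.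
subst c'; congr (_ + _).
have W p q : (forall a, (p <= a)%N -> u a = c) -> (p <= q)%N ->
    \sum_(a < p) (u a - c) = \sum_(a < q) (u a - c).
  move=> Hp pq; rewrite -!(big_mkord xpredT (fun a => u a - c)).
  rewrite (big_cat_nat (n := p) (p := q)) //= [X in _ + X]big_nat_cond [X in _ + X]big1 ?addr0 //.
  by move=> a /andP[/andP[pa _] _]; rewrite Hp // subrr.
by case/orP: (leq_total m m') => le; [rewrite (W _ _ Hm le)|rewrite (W _ _ Hm' le)].
Qed.

Lemma evconst_comp2 (g : R -> R -> R) u v :
  evconst u -> evconst v -> evconst (fun a => g (u a) (v a)).
Proof.
move=> [m [c Hm]] [m' [c' Hm']]; exists (maxn m m'), (g c c') => a.
by rewrite geq_max => /andP[ma ma']; rewrite Hm // Hm'.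
Qed.

Lemma evconst_cst c : evconst (fun=> c). Proof. by exists 0%N, c. Qed.

Lemma evconst_shift u d : evconst u -> evconst (fun a => u (a + d)%N).
Proof. by move=> [m [c Hm]]; exists m, c => a ma; apply: Hm; lia. Qed.

Lemma evconst_mask u d : evconst u -> evconst (fun a => if (d <= a)%N then u (a - d)%N else 0).
Proof.
by move=> [m [c Hm]]; exists (m + d)%N, c => a ma; rewrite ifT ?Hm //; lia.
Qed.

Lemma int1D u v : evconst u -> evconst v -> int1 (fun a => u a + v a) = int1 u + int1 v.
Proof.
move=> [m [c Hm]] [m' [c' Hm']].
rewrite (@int1E u (maxn m m') c); last by move=> a; rewrite geq_max => /andP[/Hm].
rewrite (@int1E v (maxn m m') c'); last by move=> a; rewrite geq_max => /andP[_ /Hm'].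
rewrite (@int1E _ (maxn m m') (c + c')).
  by rewrite mulrDr addrACA -big_split /=; congr (_ + _); apply: eq_bigr => a _; ring.
by move=> a; rewrite geq_max => /andP[/Hm-> /Hm'->].
Qed.

Lemma int1Z r u : evconst u -> int1 (fun a => r * u a) = r * int1 u.
Proof.
move=> [m [c Hm]]; rewrite (int1E Hm) (@int1E _ m (r * c)) => [|a /Hm-> //].
by rewrite mulrDr mulr_sumr mulrCA; congr (_ + _); apply: eq_bigr => a _; ring.
Qed.

Lemma int1_cst c : int1 (fun=> c) = x * c.
Proof. by rewrite (@int1E _ 0 c) // big_ord0 add0r. Qed.

Lemma evconst_delta b r : evconst (fun a => if a == b then r else 0).
Proof. by exists b.+1, 0 => a ba; rewrite ifF //; lia. Qed.

Lemma int1_delta b r : int1 (fun a => if a == b then r else 0) = r.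
Proof.
rewrite (@int1E _ b.+1 0); last by move=> a ba; rewrite ifF //; lia.
rewrite mulr0 addr0 big_ord_recr /= eqxx subr0 big1 ?add0r // => a _.
by rewrite subr0 ifF //; have := ltn_ord a; lia.
Qed.

(** The exceptional points form a list that may have repetitions, because this is how the terms
    found by quantifier elimination supply them. *)
Lemma int1_exc (vs : seq nat) u c : (forall a, a \notin vs -> u a = c) ->
  int1 u = x * c + \sum_(a <- undup vs) (u a - c).
Proof.
move=> Hu; have [m Hm] : exists m, forall a, (m <= a)%N -> a \notin vs.
  exists (\max_(v <- vs) v).+1 => a ma; apply: contraL ma => av.
  by rewrite -ltnNge ltnS; apply: (@leq_bigmax_seq _ vs xpredT id).
rewrite (@int1E _ m c); last by move=> a /Hm/Hu.
rewrite addrC; congr (_ + _); rewrite -(big_mkord xpredT (fun a => u a - c)).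
rewrite (bigID (mem vs)) /= [X in _ + X]big1 ?addr0; last first.
  by move=> a /Hu->; rewrite subrr.
rewrite -big_filter; apply: perm_big; apply: uniq_perm.
- by rewrite filter_uniq // iota_uniq.
- exact: undup_uniq.
move=> a; rewrite mem_filter mem_undup mem_index_iota /=.
by case: (boolP (a \in vs)) => //= av; rewrite ltnNge; apply: contraL av => /Hm.
Qed.

(** * Functions of two variables and Fubini *)

Variable N : nat.
Hypothesis charN : N%:R = 0 :> R.

(** Translation creates [N * K] new points at the start of the line, each contributing [- c] to the
    sum, where [c] is the eventual value. The total vanishes because [N = 0] in [R]. *)
Lemma int1_shift K u : evconst u ->
  int1 (fun a => if (N * K <= a)%N then u (a - N * K)%N else 0) = int1 u.
Proof.
move=> [m [c Hm]]; rewrite (int1E Hm) (@int1E _ (m + N * K) c); last first.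
  by move=> a ma; rewrite ifT ?Hm //; lia.
congr (_ + _); rewrite -!(big_mkord xpredT (fun a => u a - c)).
rewrite -(big_mkord xpredT (fun a => (if (N * K <= a)%N then u (a - N * K)%N else 0) - c)).
rewrite (big_cat_nat (n := (N * K)%N)) /= ?leq_addl // big_nat_cond.
rewrite (eq_bigr (fun=> - c)); last first.
  by move=> a /andP[/andP[_ ak] _]; rewrite leqNgt ak /= sub0r.
rewrite -big_nat_cond sumr_const_nat subn0 mulrnA -[_ *+ N]mulr_natr charN mulr0 mul0rn add0r.
rewrite -{1}[(N * K)%N]add0n big_addn addnK; apply: eq_bigr => a _.
by rewrite leq_addl addnK.
Qed.

(** The functions of two coordinates obtained from functions of several
    coordinates, as in [basic] below, by fixing all the others. *)
Inductive tame2 : (nat -> nat -> R) -> Prop :=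
| Tame_sep u v : evconst u -> evconst v -> tame2 (fun a b => u a * v b)
| Tame_up u K : evconst u -> tame2 (fun a b => if b == (a + N * K)%N then u a else 0)
| Tame_down u K : evconst u -> tame2 (fun a b => if a == (b + N * K)%N then u b else 0)
| Tame_add h k : tame2 h -> tame2 k -> tame2 (fun a b => h a b + k a b).

Lemma tame2_ext h k : (forall a b, h a b = k a b) -> tame2 h -> tame2 k.
Proof. by move=> E; suff -> : h = k by []; apply/funext=> a; apply/funext=> b. Qed.

Lemma tame2_tr h : tame2 h -> tame2 (fun a b => h b a).
Proof.
elim=> {h} [u v eu ev|u K eu|u K eu|h k _ Th _ Tk].
- by apply: tame2_ext (Tame_sep ev eu) => a b; rewrite mulrC.
- exact: Tame_down.
- exact: Tame_up.
- exact: Tame_add.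
Qed.

Lemma tame2_cst c : tame2 (fun _ _ => c).
Proof.
by apply: tame2_ext (Tame_sep (evconst_cst c) (evconst_cst 1)) => a b; rewrite mulr1.
Qed.

Lemma tame2_mull w h : evconst w -> tame2 h -> tame2 (fun a b => w a * h a b).
Proof.
move=> ew; elim=> {h} [u v eu ev|u K eu|u K eu|h k _ Th _ Tk].
- apply: tame2_ext (Tame_sep (evconst_comp2 *%R ew eu) ev) => a b.
  by rewrite mulrA.
- apply: tame2_ext (Tame_up K (evconst_comp2 *%R ew eu)) => a b.
  by case: eqP; rewrite ?mulr0.
- apply: tame2_ext (Tame_down K (evconst_comp2 *%R (evconst_shift (N * K) ew) eu)) => a b.
  by case: eqP => [->|]; rewrite ?mulr0.
- by apply: tame2_ext (Tame_add Th Tk) => a b; rewrite mulrDr.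
Qed.

(** Two upward graphs coincide or are disjoint, and an upward graph meets a downward one only if
    both are the diagonal. The offsets [N * K] are compared rather than [K] because [N] may be 0
    here. *)
Lemma tame2_mulup K h : tame2 h ->
  tame2 (fun a b => if b == (a + N * K)%N then h a b else 0).
Proof.
elim=> {h} [u v eu ev|u K' eu|u K' eu|h k _ Th _ Tk].
- apply: tame2_ext (Tame_up K (evconst_comp2 *%R eu (evconst_shift (N * K) ev))) => a b /=.
  by case: eqP => [->|].
- have [E|E] := eqVneq (N * K)%N (N * K')%N.
    apply: tame2_ext (Tame_up K eu) => a b.
    by rewrite E; case: eqP.
  apply: tame2_ext (tame2_cst 0) => a b.
  by do 2 case: eqP => //; lia.
- have [E|E] := boolP ((N * K == 0) && (N * K' == 0))%N.
    apply: tame2_ext (Tame_down K' eu) => a b.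
    case/andP: E => /eqP-> /eqP->; rewrite !addn0.
    by case: (eqVneq b a).
  apply: tame2_ext (tame2_cst 0) => a b.
  by do 2 case: eqP => //; lia.
- apply: tame2_ext (Tame_add Th Tk) => a b.
  by case: eqP => //; rewrite addr0.
Qed.

Lemma tame2_muldown K h : tame2 h ->
  tame2 (fun a b => if a == (b + N * K)%N then h a b else 0).
Proof. by move=> /tame2_tr/(tame2_mulup K)/tame2_tr. Qed.

Lemma int1_up u K a : int1 (fun b => if b == (a + N * K)%N then u a else 0) = u a.
Proof. exact: int1_delta. Qed.

Lemma int1_down u K b : int1 (fun b' => if b == (b' + N * K)%N then u b' else 0) =
  if (N * K <= b)%N then u (b - N * K)%N else 0.
Proof.
rewrite -[RHS](int1_delta (b - N * K)%N); congr int1; apply/funext => b'.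
case: (eqVneq b' (b - N * K)%N) => [->|E].
  by case: leqP => H; [rewrite subnK ?eqxx|rewrite ifF //; lia].
by rewrite ifF //; lia.
Qed.

(** Fubini, by induction on tame functions. Eventual constancy of rows, columns and marginals is
    carried along because additivity of the integral requires it. The characteristic enters only for
    the graphs, whose two marginals are [u] and its translate by [N * K]. *)
Lemma tame2_rowcol h : tame2 h -> [/\ forall a, evconst (h a), forall b, evconst (h^~ b),
  evconst (fun a => int1 (h a)), evconst (fun b => int1 (h^~ b)) &
  int1 (fun a => int1 (h a)) = int1 (fun b => int1 (h^~ b))].
Proof.
elim=> {h} [u v eu ev|u K eu|u K eu|h k _ [h1 h2 h3 h4 h5] _ [k1 k2 k3 k4 k5]].
- have E a : int1 (fun b => u a * v b) = int1 v * u a by rewrite int1Z // mulrC.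
  have F b : int1 (fun a => u a * v b) = int1 u * v b.
    by rewrite mulrC -int1Z //; congr int1; apply/funext => a; rewrite mulrC.
  split.
  + by move=> a; apply: (evconst_comp2 *%R) ev; apply: evconst_cst.
  + by move=> b; apply: (evconst_comp2 *%R) eu _; apply: evconst_cst.
  + under eq_fun do rewrite E; exact: (evconst_comp2 *%R (evconst_cst _)).
  + under eq_fun do rewrite F; exact: (evconst_comp2 *%R (evconst_cst _)).
  + under eq_fun do rewrite E; under [X in _ = int1 X]eq_fun do rewrite F.
    by rewrite !int1Z // mulrC.
- split.
  + by move=> a; apply: evconst_delta.
  + move=> b; exists b.+1, 0 => a ab; rewrite ifF //; lia.
  + by under eq_fun do rewrite int1_up.
  + under eq_fun do rewrite int1_down; exact: evconst_mask.
  + under eq_fun do rewrite int1_up; under [X in _ = int1 X]eq_fun do rewrite int1_down.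
    by rewrite int1_shift.
- split.
  + move=> b; exists b.+1, 0 => a ab; rewrite ifF //; lia.
  + by move=> a; apply: evconst_delta.
  + under eq_fun do rewrite int1_down; exact: evconst_mask.
  + by under eq_fun do rewrite int1_up.
  + under [X in _ = int1 X]eq_fun do rewrite int1_up; under eq_fun do rewrite int1_down.
    by rewrite int1_shift.
- have E : (fun a => int1 (fun b => h a b + k a b)) = (fun a => int1 (h a) + int1 (k a)).
    by apply/funext => a; rewrite int1D.
  have F : (fun b => int1 (fun a => h a b + k a b)) = (fun b => int1 (h^~ b) + int1 (k^~ b)).
    by apply/funext => a; rewrite int1D.
  by rewrite E F !int1D // h5 k5; split=> // *; apply: (evconst_comp2 +%R).
Qed.

End Integral.
(** * Quantifier elimination *)

Section Chain.
Variable N : nat.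

Definition chain_sig : signature :=
  @Signature void (fun=> 0%N) nat (fun=> 2%N).

Definition chain : structure chain_sig :=
  @Structure chain_sig nat (inhabits 0%N) (fun f => match f with end)
    (fun k p => tnth p ord_max = (tnth p ord0 + N * k)%N).

Notation env := (nat -> nat).

(** [(Some j, k)] stands for [x_j + N * k] and [(None, d)] for [d]. *)
Definition zterm : Type := option nat * int.

Definition zval (e : env) (s : zterm) : int :=
  if s.1 is Some j then (e j)%:Z + N%:Z * s.2 else s.2.

Definition zshift (s : zterm) (k : int) : zterm :=
  if s.1 is Some j then (Some j, s.2 + k) else (None, s.2 + N%:Z * k).

Lemma zval_shift e s k : zval e (zshift s k) = zval e s + N%:Z * k.
Proof. by case: s => [[j|] l]; rewrite /zval /zshift /=; ring. Qed.

Definition zsub (t s : zterm) : zterm :=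
  match s with
  | (Some 0%N, k) => zshift t k
  | (Some j.+1, k) => (Some j, k)
  | (None, d) => (None, d)
  end.

Local Notation cons a e := (@consenv chain_sig chain a e).
Local Notation cpre n e := (@pre chain_sig chain n e).

Lemma zval_sub e t s a : zval e t = a%:Z -> zval (cons a e) s = zval e (zsub t s).
Proof.
move=> Et; case: s => [[[|j]|] k] //=.
by rewrite zval_shift Et.
Qed.

Definition zren (f : nat -> nat) (s : zterm) : zterm := (omap f s.1, s.2).

Lemma zval_ren e f s : zval (e \o f) s = zval e (zren f s).
Proof. by case: s => [[j|] k]. Qed.

(** Shifts may be negative, so a term need not denote an element of the structure; the second kind
    of atom records whether it does. *)
Definition atom : Type := (zterm * zterm + zterm)%type.

Definition aval (e : env) (p : atom) : bool :=
  match p with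
  | inl (s, t) => zval e s == zval e t
  | inr s => (0 <= zval e s)%R
  end.

Definition asub (t : zterm) (p : atom) : atom :=
  match p with
  | inl (s, s') => inl (zsub t s, zsub t s')
  | inr s => inr (zsub t s)
  end.

Lemma aval_sub e t p a : zval e t = a%:Z -> aval (cons a e) p = aval e (asub t p).
Proof. by move=> Et; case: p => [[s s']|s] /=; rewrite !(zval_sub _ Et). Qed.

Definition aren (f : nat -> nat) (p : atom) : atom :=
  match p with
  | inl (s, s') => inl (zren f s, zren f s')
  | inr s => inr (zren f s)
  end.

Lemma aval_ren e f p : aval (e \o f) p = aval e (aren f p).
Proof. by case: p => [[s s']|s] /=; rewrite !(zval_ren e f). Qed.

(** [phi e] depends only on the truth values of finitely many atoms at [e]. *)
Definition basic (T : Type) (phi : env -> T) : Prop := exists L : seq atom,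
  forall e e', {in L, aval e =1 aval e'} -> phi e = phi e'.

Lemma basic_atom p : basic (aval^~ p).
Proof. by exists [:: p] => e e'; apply; rewrite mem_head. Qed.

Lemma basic_comp T U (g : T -> U) phi : basic phi -> basic (fun e => g (phi e)).
Proof. by move=> [L H]; exists L => e e' /H ->. Qed.

Lemma basic_comp2 T U V (g : T -> U -> V) phi psi : basic phi -> basic psi ->
  basic (fun e => g (phi e) (psi e)).
Proof.
move=> [L H] [L' H']; exists (L ++ L') => e e' E.
by congr g; [apply: H|apply: H'] => p pL; apply: E; rewrite mem_cat pL ?orbT.
Qed.

Lemma basic_ren T (phi : env -> T) f : basic phi -> basic (fun e => phi (e \o f)).
Proof.
move=> [L H]; exists (map (aren f) L) => e e' E; apply: H => p pL.
by rewrite !(aval_ren _ f); apply: E; apply: map_f.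
Qed.

(** The values of the first variable at which [p] may fail to have its generic
    truth value are among the natural numbers denoted by these terms. *)
Definition exceptional (p : atom) : seq zterm :=
  match p with
  | inl (s, s') => [:: zshift (zsub (None, 0) s) (- s'.2);
                       zshift (zsub (None, 0) s') (- s.2)]
  | inr s => [seq (None, i%:Z) | i <- iota 0 (N * `|s.2|)]
  end.

Definition avoids (e : env) (T : seq zterm) (a : nat) : Prop :=
  forall t, t \in T -> zval e t <> a%:Z.

(** If [x_0] stands on one side of an equation, avoidance makes it false; on both sides, [x_0]
    cancels; in an inequality, avoidance makes it true. An atom without [x_0] is decided by the
    hypothesis on [asub], which then merely renumbers the variables. *)
Lemma aval_generic e e' a a' p :
  avoids e (exceptional p) a -> avoids e' (exceptional p) a' ->
  aval e (asub (None, 0) p) = aval e' (asub (None, 0) p) ->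
  aval (cons a e) p = aval (cons a' e') p.
Proof.
have ge b f k : avoids f (exceptional (inr (Some 0%N, k))) b ->
    (0 <= zval (cons b f) (Some 0%N, k)) = true.
  move=> Hb; rewrite leNgt; apply/negP => lt; apply: (Hb (None, b%:Z)) => //.
  apply: map_f; rewrite mem_iota /= add0n; rewrite /zval /= in lt.
  case: k lt {Hb} => k; first by lia.
  by rewrite NegzE /= ; nia.
have neq b f k s : zval (cons b f) s = zval f (zsub (None, 0) s) ->
    zval f (zshift (zsub (None, 0) s) (- k)) <> b%:Z ->
    (zval (cons b f) (Some 0%N, k) == zval (cons b f) s) = false.
  move=> ->; rewrite zval_shift => Hb; apply/eqP => E; apply: Hb; rewrite -E /zval /=.
  by ring.
have neq' b f k s : zval (cons b f) s = zval f (zsub (None, 0) s) ->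
    zval f (zshift (zsub (None, 0) s) (- k)) <> b%:Z ->
    (zval (cons b f) s == zval (cons b f) (Some 0%N, k)) = false.
  by move=> Es Hb; rewrite eq_sym neq.
case: p => [[[[[|j]|] k] [[[|j']|] k']]|[[[|j]|] k]] Ha Ha' //=.
- by move=> _; rewrite /zval /= !(inj_eq (addrI _)).
- by move=> _; rewrite !neq //; [apply: Ha'|apply: Ha]; rewrite !inE eqxx orbT.
- by move=> _; rewrite !neq //; [apply: Ha'|apply: Ha]; rewrite !inE eqxx orbT.
- by move=> _; rewrite !neq' //; [apply: Ha'|apply: Ha]; rewrite !inE eqxx.
- by move=> _; rewrite !neq' //; [apply: Ha'|apply: Ha]; rewrite !inE eqxx.
- by move=> _; rewrite !ge.
Qed.

Lemma avoids_large e T : exists m, forall a, (m <= a)%N -> avoids e T a.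
Proof.
exists (\max_(t <- T) `|zval e t|).+1 => a ma t tT E; move: ma; apply/negP.
rewrite -ltnNge ltnS.
have := @leq_bigmax_seq _ T xpredT (fun t => `|zval e t|%N) t tT isT.
by rewrite E.
Qed.

(** The atoms [L'] describe the fibre over an environment: which terms of [T] denote points, which
    of these points coincide, and how [L] evaluates at each of them and at the generic remainder.
    Two environments that agree on [L'] thus have matching fibres. *)
Lemma elim_var (L : seq atom) : exists (L' : seq atom) (T : seq zterm),
  forall e e', {in L', aval e =1 aval e'} ->
  [/\ forall a a', avoids e T a -> avoids e' T a' ->
        {in L, aval (cons a e) =1 aval (cons a' e')},
      {in T, forall t, (0 <= zval e t) = (0 <= zval e' t)},
      {in T &, forall s t, (zval e s == zval e t) = (zval e' s == zval e' t)} &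
      {in T, forall t a a', zval e t = a%:Z -> zval e' t = a'%:Z ->
        {in L, aval (cons a e) =1 aval (cons a' e')}}].
Proof.
(* The term 0 is put in [T] because [aval_generic] compares atoms after substituting it for
   [x_0]. *)
have [T [T0 TL]] : exists T : seq zterm, (None, 0) \in T /\
    forall p, p \in L -> {subset exceptional p <= T}.
  exists ((None, 0) :: flatten (map exceptional L)); split; first exact: mem_head.
  move=> p pL t tp; rewrite inE; apply/orP; right.
  by apply/flattenP; exists (exceptional p) => //; apply: map_f.
exists ([seq asub t p | t <- T, p <- L] ++ [seq inr t | t <- T] ++
  [seq inl (s, t) | s <- T, t <- T]), T => e e' E.
have sub t p : t \in T -> p \in L -> aval e (asub t p) = aval e' (asub t p).
  by move=> tT pL; apply: E; rewrite mem_cat allpairs_f.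
split.
- move=> a a' Ha Ha' p pL; apply: aval_generic; last exact: sub.
    by move=> t /(TL _ pL)/Ha.
  by move=> t /(TL _ pL)/Ha'.
- by move=> t tT; apply: (E (inr t)); rewrite !mem_cat map_f ?orbT.
- move=> s t sT tT; apply: (E (inl (s, t))); rewrite !mem_cat.
  by rewrite (allpairs_f (fun s t => inl (s, t))) ?orbT.
- by move=> t tT a a' Ea Ea' p pL; rewrite (aval_sub _ Ea) (aval_sub _ Ea') sub.
Qed.

(** A witness over [e] is carried to [e']: an exceptional one goes to the point denoted by the same
    term, a generic one to any sufficiently large number. *)
Lemma basic_ex (P : env -> Prop) : basic P -> basic (fun e => exists a, P (cons a e)).
Proof.
move=> [L H]; have [L' [T H']] := elim_var L; exists L'.
suff W e e' : {in L', aval e =1 aval e'} ->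
    (exists a, P (cons a e)) -> exists a, P (cons a e').
  move=> e e' E; apply/propext; split; apply: W; [exact: E|by move=> p /E].
move=> E [a Pa]; have [gen pos _ spe] := H' _ _ E.
have [[t [tT ta]]|na] := pselect (exists t, t \in T /\ zval e t = a%:Z).
  exists `|zval e' t|%N; rewrite -(H (cons a e)) //.
  by apply: (spe _ tT _ _ ta); rewrite gez0_abs // -pos // ta.
have [m Hm] := avoids_large e' T; exists m.
rewrite -(H (cons a e)) //; apply: gen; last exact: Hm.
by move=> t tT ta; apply: na; exists t.
Qed.

Variables (R : comPzRingType) (x : R).

(** By [int1_exc] the integral is determined by the generic value and the values at the exceptional
    points; matching fibres share both. *)
Lemma basic_int1 (phi : env -> R) : basic phi ->
  basic (fun e => int1 x (fun a => phi (cons a e))).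
Proof.
move=> [L H]; have [L' [T H']] := elim_var L; exists L' => e e' E.
have [gen pos eqv spe] := H' _ _ E.
(* Terms with a negative value denote no point and are dropped. *)
pose vals (d : env) U := [seq `|t|%N | t <- [seq zval d t | t <- U] & (0 <= t)%R].
have valsP d U t : (0 <= zval d t) ->
    (`|zval d t|%N \in vals d U) = has (fun s => zval d s == zval d t) U.
  move=> t0; apply/mapP/hasP => [[v]|[s sU /eqP st]].
    rewrite mem_filter => /andP[v0 /mapP[s sU Ev]] Et; exists s => //.
    by rewrite -Ev -(gez0_abs v0) -(gez0_abs t0) Et.
  by exists (zval d s); rewrite ?st // mem_filter t0 -st map_f.
have avo d a : a \notin vals d T -> avoids d T a.
  move=> na t tT ta; move: na; have t0 : 0 <= zval d t by rewrite ta.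
  have -> : a = `|zval d t|%N by rewrite ta.
  by rewrite valsP // => /hasPn/(_ _ tT); rewrite eqxx.
have [m Hm] := avoids_large e T; have [m' Hm'] := avoids_large e' T.
pose c := phi (cons m e).
have Hc a : a \notin vals e T -> phi (cons a e) = c.
  move=> /avo na; have nm' := Hm' _ (leqnn m').
  by rewrite /c (H _ _ (gen _ _ na nm')) (H _ _ (gen _ _ (Hm _ (leqnn m)) nm')).
have Hc' a : a \notin vals e' T -> phi (cons a e') = c.
  by move=> /avo na; rewrite /c (H _ _ (gen _ _ (Hm _ (leqnn m)) na)).
rewrite (int1_exc x Hc) (int1_exc x Hc'); congr (_ + _).
(* The two sums are compared by induction on a sublist of [T]: [undup] drops the head on both sides
   or on neither, since the terms have the same coincidences at [e] and [e']. *)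
have : {subset T <= T} by [].
elim: {1 3 4}T => [|t U IH] tU; first by rewrite !big_nil.
have tT : t \in T by apply: tU; rewrite mem_head.
have {}tU : {subset U <= T} by move=> s sU; apply: tU; rewrite inE sU orbT.
have {}IH := IH tU; rewrite /vals /= -(pos _ tT); case: ifP => //= t0.
have t0' : 0 <= zval e' t by rewrite -pos.
rewrite -!/(vals _ _) !valsP //.
rewrite (@eq_in_has _ _ (fun s => zval e' s == zval e' t)); last first.
  by move=> s /tU sT /=; rewrite eqv.
case: ifP => // _; rewrite !big_cons IH; congr (_ - _ + _); apply: H.
by apply: (spe _ tT); rewrite gez0_abs.
Qed.

Lemma eval_zterm n (t : term chain n) : exists s, forall e : env,
  eval (cpre n e) t = zval e s :> int.
Proof.
case: t => [i|a|[]]; last by exists (None, a%:Z).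
by exists (Some (val i), 0) => e; rewrite /zval /= mulr0 addr0 (tnth_pre, tnth_mktuple).
Qed.

Lemma basic_holds n (phi : formula chain n) : basic (fun e => holds phi (cpre n e)).
Proof.
elim: phi => {n} [n s t|n k args|n p IH|n p IHp q IHq|n p IH] /=.
- have [s' Es] := eval_zterm s; have [t' Et] := eval_zterm t.
  have := basic_comp is_true (basic_atom (inl (s', t'))).
  congr basic; apply/funext => e; apply/propext; rewrite /= -Es -Et.
  by split=> [/eqP[]|->].
- have [s' Es] := eval_zterm (args ord0); have [t' Et] := eval_zterm (args ord_max).
  have := basic_comp is_true (basic_atom (inl (t', zshift s' k%:Z))).
  congr basic; apply/funext => e; apply/propext; rewrite /= zval_shift -Es -Et !tnth_mktuple.
  by split=> [/eqP|]; lia.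
- exact: basic_comp.
- exact: basic_comp2.
- have := basic_ex IH; congr basic; apply/funext => e; apply/propext.
  have E a : cpre n.+1 (cons a e) = [tuple of a :: cpre n e].
    apply: eq_from_tnth => i; rewrite (tnth_pre, tnth_mktuple).
    by case: (unliftP ord0 i) => [j|] ->; rewrite ?tnthS ?(tnth_pre, tnth_mktuple) ?tnth0.
  by split=> -[a]; exists a; [rewrite -E|rewrite E].
Qed.

Lemma basic_dp (P : env -> Prop) : @dp _ chain P -> basic P.
Proof.
move=> [k [phi H]]; have := basic_holds phi; congr basic; apply/funext => e.
by apply/propext; rewrite H.
Qed.

(** This form allows induction on the list of atoms. Truth patterns realized by no environment
    receive a default, the value of [phi] at the zero environment. *)
Lemma basic_factor T (phi : env -> T) : basic phi -> exists L F,
  forall e, phi e = F (map (aval e) L).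
Proof.
move=> [L H]; exists L.
exists (fun s => if pselect (exists e, map (aval e) L = s) is left h
  then phi (projT1 (cid h)) else phi (fun=> 0%N)) => e.
case: pselect => [h|[]]; last by exists e.
by case: cid => e' /= /eq_in_map E; apply: H => p /E.
Qed.

End Chain.

(** * Iterated integrals *)

Section Measure.
Variables (N : nat) (R : comPzRingType) (x : R).
Hypothesis charN : N%:R = 0 :> R.

Notation env := (nat -> nat).
Implicit Types (phi psi : env -> R) (e : env).

Definition upd e (i a : nat) : env := fun j => if j == i then a else e j.

Lemma tame2_ifl (P : pred nat) h : (exists m c, forall a, (m <= a)%N -> P a = c) ->
  tame2 N h -> tame2 N (fun a b => if P a then h a b else 0 : R).
Proof.
move=> [m [c Hm]] Th; apply: tame2_ext (@tame2_mull R N (fun a => (P a)%:R) _ _ Th).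
  by move=> a b; case: (P a); rewrite (mul1r, mul0r).
by exists m, c%:R => a /Hm->.
Qed.

Lemma tame2_ifr (P : pred nat) h : (exists m c, forall a, (m <= a)%N -> P a = c) ->
  tame2 N h -> tame2 N (fun a b => if P b then h a b else 0 : R).
Proof. by move=> HP /tame2_tr/(tame2_ifl HP)/tame2_tr. Qed.

Lemma zval_upd2 e i j s :
  [\/ exists k, forall a b, zval N (upd (upd e i a) j b) s = a%:Z + N%:Z * k,
      exists k, forall a b, zval N (upd (upd e i a) j b) s = b%:Z + N%:Z * k |
      exists c, forall a b, zval N (upd (upd e i a) j b) s = c].
Proof.
case: s => [[l|] k]; last by constructor 3; exists k.
rewrite /zval /upd /=; have [_|_] := eqVneq l j; first by constructor 2; exists k.
have [_|_] := eqVneq l i; first by constructor 1; exists k.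
by constructor 3; exists ((e l)%:Z + N%:Z * k).
Qed.

Lemma tame2_if_ge (h : nat -> nat -> R) (v : nat -> nat -> int) :
  [\/ exists k, forall a b, v a b = a%:Z + N%:Z * k,
      exists k, forall a b, v a b = b%:Z + N%:Z * k |
      exists c, forall a b, v a b = c] ->
  tame2 N h -> tame2 N (fun a b => if 0 <= v a b then h a b else 0).
Proof.
have ge (k : int) : exists m c, forall a, (m <= a)%N -> (0 <= a%:Z + N%:Z * k) = c.
  exists (absz (N%:Z * k)), true => a; lia.
move=> [] [k E] Th.
- by apply: tame2_ext (tame2_ifl (ge k) Th) => a b; rewrite E.
- by apply: tame2_ext (tame2_ifr (ge k) Th) => a b; rewrite E.
- have [k0|k0] := boolP (0 <= k).
    by apply: tame2_ext Th => a b; rewrite E k0.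
  by apply: tame2_ext (tame2_cst N 0) => a b; rewrite E (negPf k0).
Qed.

Lemma tame2_if_eq (h : nat -> nat -> R) (v w : nat -> nat -> int) :
  [\/ exists k, forall a b, v a b = a%:Z + N%:Z * k,
      exists k, forall a b, v a b = b%:Z + N%:Z * k |
      exists c, forall a b, v a b = c] ->
  [\/ exists k, forall a b, w a b = a%:Z + N%:Z * k,
      exists k, forall a b, w a b = b%:Z + N%:Z * k |
      exists c, forall a b, w a b = c] ->
  tame2 N h -> tame2 N (fun a b => if v a b == w a b then h a b else 0).
Proof.
move=> Hv Hw Th.
have eqc (k c : int) : exists m d, forall a, (m <= a)%N -> (a%:Z + N%:Z * k == c) = d.
  exists (absz (c - N%:Z * k)%R).+1, false => a; lia.
have cst c d : tame2 N (fun a b => if c == d :> int then h a b else 0).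
  by case: (c == d) => //; apply: tame2_cst.
(* The sign of [k' - k] decides whether the equation is a downward or an upward graph with a natural
   offset. *)
have ab (k k' : int) : tame2 N (fun a b =>
    if a%:Z + N%:Z * k == b%:Z + N%:Z * k' then h a b else 0).
  case: (leP k k') => kk.
    have [K EK] : exists K : nat, k' = k + K%:Z by exists (absz (k' - k)); lia.
    apply: tame2_ext (tame2_muldown K Th) => a b; congr (if _ then _ else _).
    by apply/eqP/eqP; rewrite EK; lia.
  have [K EK] : exists K : nat, k = k' + K%:Z by exists (absz (k - k')); lia.
  apply: tame2_ext (tame2_mulup K Th) => a b; congr (if _ then _ else _).
  by apply/eqP/eqP; rewrite EK; lia.
case: Hv => -[k E]; case: Hw => -[k' E'].
- apply: tame2_ext (cst (N%:Z * k) (N%:Z * k')) => a b.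
  by rewrite E E' (inj_eq (addrI _)).
- by apply: tame2_ext (ab k k') => a b; rewrite E E'.
- by apply: tame2_ext (tame2_ifl (eqc k k') Th) => a b; rewrite E E'.
- by apply: tame2_ext (ab k' k) => a b; rewrite E E' eq_sym.
- apply: tame2_ext (cst (N%:Z * k) (N%:Z * k')) => a b.
  by rewrite E E' (inj_eq (addrI _)).
- by apply: tame2_ext (tame2_ifr (eqc k k') Th) => a b; rewrite E E'.
- by apply: tame2_ext (tame2_ifl (eqc k' k) Th) => a b; rewrite E E' eq_sym.
- by apply: tame2_ext (tame2_ifr (eqc k' k) Th) => a b; rewrite E E' eq_sym.
- by apply: tame2_ext (cst k k') => a b; rewrite E E'.
Qed.

Lemma basic_tame2 phi e i j : basic N phi ->
  tame2 N (fun a b => phi (upd (upd e i a) j b)).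
Proof.
move=> /basic_factor[L [F EF]]; pose E a b := upd (upd e i a) j b.
suff H : tame2 N (fun a b => F (map (aval N (E a b)) L)).
  by apply: tame2_ext H => a b; rewrite EF.
elim: L {EF} F => [|p L IH] F; first exact: (tame2_cst N (F [::])).
have Hp h : tame2 N h -> tame2 N (fun a b => if aval N (E a b) p then h a b else 0 : R).
  by case: p => [[s t]|s]; [apply: tame2_if_eq|apply: tame2_if_ge]; apply: zval_upd2.
have Ht := IH (fun s => F (true :: s)); have Hf := IH (fun s => F (false :: s)).
(* Splitting on the truth of [p] gives [1_p F_true + F_false - 1_p F_false], where [F_true] and
   [F_false] fix the first entry of the argument of [F]. *)
apply: tame2_ext (Tame_add (Hp _ Ht) (Tame_add Hf
  (tame2_mull (evconst_cst (-1)) (Hp _ Hf)))) => a b /=.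
by case: (aval N (E a b) p); ring.
Qed.

Definition intv i phi : env -> R := fun e => int1 x (fun a => phi (upd e i a)).

Lemma basic_intv i phi : basic N phi -> basic N (intv i phi).
Proof.
(* Renaming [i] to 0 and every other [j] to [j.+1] turns integration over [x_i] into integration
   over [x_0]. *)
move=> /(basic_ren (fun j => if j == i then 0%N else j.+1))/(basic_int1 x).
congr basic; apply/funext => e; congr int1; apply/funext => a; congr phi.
by apply/funext => j; rewrite /upd /=; case: eqP.
Qed.

Lemma upd_same e i : upd e i (e i) = e.
Proof. by apply/funext => j; rewrite /upd; case: eqP => [->|]. Qed.

Lemma updC e i j a b : i != j -> upd (upd e i a) j b = upd (upd e j b) i a.
Proof.
move=> ij; apply/funext => l; rewrite /upd; case: (eqVneq l j) => [->|//].
by rewrite eq_sym (negPf ij).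
Qed.

Lemma basic_evconst phi i e : basic N phi -> evconst (fun a => phi (upd e i a)).
Proof.
(* The variable [i.+1] serves as second variable; at its own value [e i.+1] the column is the given
   function. *)
move=> /(@basic_tame2 _ e i i.+1)/(tame2_rowcol x charN)[_ /(_ (e i.+1)) + _ _ _].
congr evconst; apply/funext => a; rewrite updC ?upd_same //.
by rewrite neq_ltn ltnSn.
Qed.

Lemma intvC i j phi : basic N phi -> intv i (intv j phi) = intv j (intv i phi).
Proof.
move=> Hphi; have [->//|ij] := eqVneq i j.
apply/funext => e; have [_ _ _ _ E] := tame2_rowcol x charN (basic_tame2 e i j Hphi).
rewrite /intv E; congr int1; apply/funext => b; congr int1; apply/funext => a.
by rewrite updC.
Qed.

Definition intl (s : seq nat) phi : env -> R := foldr intv phi s.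

Lemma basic_intl s phi : basic N phi -> basic N (intl s phi).
Proof. by move=> H; elim: s => //= i s; apply: basic_intv. Qed.

Lemma intl_intv s i phi : basic N phi -> intl s (intv i phi) = intv i (intl s phi).
Proof.
by move=> H; elim: s => //= j s ->; rewrite intvC //; apply: basic_intl.
Qed.

Lemma intlC s t phi : basic N phi -> intl s (intl t phi) = intl t (intl s phi).
Proof.
move=> H; elim: s => //= i s ->; rewrite intl_intv //; exact: basic_intl.
Qed.

(** By [intl_agree], the integral [intl s phi e] depends only on the values of [phi] at environments
    of this form. *)
Definition splice (s : seq nat) (d e : env) : env :=
  fun j => if j \in s then d j else e j.

Lemma splice_upd s d e i a :
  splice s d (upd e i a) = splice (i :: s) (fun j => if j \in s then d j else a) e.
Proof.
apply/funext => j; rewrite /splice /upd inE; case: (boolP (j \in s)) => js.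
  by rewrite orbT.
by rewrite orbF.
Qed.

Lemma intl_agree s phi psi e e' :
  (forall d, phi (splice s d e) = psi (splice s d e')) -> intl s phi e = intl s psi e'.
Proof.
elim: s e e' => [|i s IH] e e' H /=; first exact: (H (fun=> 0%N)).
rewrite /intv; congr int1; apply/funext => a; apply: IH => d.
by rewrite !splice_upd.
Qed.

(** Each variable of [s] integrates one factor of a point mass. A repeated variable would be
    integrated again as a constant and give a factor [x], hence [uniq s]. *)
Lemma intl_delta s phi r (y : env) e : uniq s ->
  (forall d, phi (splice s d e) = if all (fun j => d j == y j) s then r else 0) ->
  intl s phi e = r.
Proof.
elim: s r e => [|i s IH] r e /=; first by move=> _ /(_ (fun=> 0%N)).
move=> /andP[ni us] H; rewrite /intv.
rewrite -[RHS](int1_delta x (y i)); congr int1; apply/funext => a.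
apply: IH => // d; rewrite splice_upd H (negPf ni).
rewrite (@eq_in_all _ _ (fun j => d j == y j)); last by move=> j ->.
by case: eqP => //=; case: all.
Qed.

Lemma intlM s phi psi e : basic N psi -> (forall d, phi (splice s d e) = phi e) ->
  intl s (fun d => phi d * psi d) e = phi e * intl s psi e.
Proof.
move=> Hpsi; elim: s e => [|i s IH] e H //=.
rewrite /intv -int1Z; last exact: basic_evconst (basic_intl _ Hpsi).
have E a : phi (upd e i a) = phi e.
  rewrite -(H (upd e i a)); congr phi; apply/funext => j; rewrite /splice /upd inE.
  by case: (j == i); case: (j \in s).
congr int1; apply/funext => a; rewrite IH E // => d.
by rewrite splice_upd H.
Qed.

Lemma intlD s phi psi : basic N phi -> basic N psi ->
  intl s (fun d => phi d + psi d) = (fun e => intl s phi e + intl s psi e).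
Proof.
move=> Hphi Hpsi; elim: s => //= i s ->; apply/funext => e.
by rewrite /intv int1D //; apply: basic_evconst; apply: basic_intl.
Qed.

Lemma intl_ren (f : nat -> nat) s phi e : injective f ->
  intl (map f s) (fun d => phi (d \o f)) e = intl s phi (e \o f).
Proof.
move=> fI; elim: s e => //= i s IH e; rewrite /intv; congr int1; apply/funext => a.
rewrite IH; congr (intl s phi); apply/funext => j; rewrite /upd /=.
by rewrite (inj_eq fI).
Qed.

End Measure.

(** * The Euler characteristic *)

Section EulerCharacteristic.
Variables (N : nat) (R : comPzRingType) (x : R).
Hypothesis charN : N%:R = 0 :> R.

Local Notation M := (chain N).
Local Notation env := (nat -> nat).
Local Notation cpre n e := (@pre chain_sig M n e).
Local Notation cshift n e := (@shift chain_sig M n e).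

Definition ind n (A : set (n.-tuple M)) (e : env) : R := (`[< A (cpre n e) >])%:R.

Lemma basic_bool (P : env -> Prop) :
  basic N P -> basic N (fun e => (`[< P e >])%:R : R).
Proof. exact: (basic_comp (fun Q => (`[< Q >])%:R : R)). Qed.

Lemma basic_ind n (A : set (n.-tuple M)) : definable A -> basic N (ind A).
Proof. by move=> dA; apply/basic_bool/basic_dp/(dp_set dA)/simple_pre. Qed.

Definition chi n (A : set (n.-tuple M)) : R := intl x (iota 0 n) (ind A) (fun=> 0%N).

Lemma pre_shift_splice n m (d e : env) :
  cpre m (cshift n (splice (iota n m) d e)) = cpre m (cshift n d).
Proof.
apply: eq_from_tnth => i; rewrite !(tnth_pre, tnth_mktuple) /shift /splice.
by rewrite mem_iota leq_addr ltn_add2l ltn_ord.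
Qed.

Lemma pre_splice_ge n m (d e : env) : cpre n (splice (iota n m) d e) = cpre n e.
Proof.
apply: eq_from_tnth => i; rewrite !(tnth_pre, tnth_mktuple) /splice.
by rewrite mem_iota leqNgt ltn_ord.
Qed.

Lemma shift_splice n (d e : env) : cshift n (splice (iota 0 n) d e) = cshift n e.
Proof.
apply/funext => i; rewrite /shift /splice mem_iota add0n.
by rewrite ltnNge leq_addr.
Qed.

Lemma pre_shiftP n m (d : env) (y : m.-tuple M) :
  cpre m (cshift n d) = y <->
  all (fun j => d j == nth 0%N (y : seq nat) (j - n)%N) (iota n m).
Proof.
split=> [<-|/allP H].
  apply/allP => j; rewrite mem_iota => /andP[nj jm]; apply/eqP.
  have jm' : (j - n < m)%N by lia.
  have := tnth_pre (cshift n d : nat -> M) (Ordinal jm').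
  rewrite (tnth_nth (0%N : M)) /= => ->.
  by rewrite /shift subnKC.
apply: eq_from_tnth => i; rewrite (tnth_pre, tnth_mktuple) (tnth_nth (0%N : M)).
have := H (n + i)%N; rewrite mem_iota leq_addr ltn_add2l ltn_ord => /(_ isT)/eqP.
by rewrite addKn.
Qed.

(** Meant for the fibres of the graph of a bijection, which consist of one point over the domain and
    are empty elsewhere. *)
Lemma intl_fun n m (phi : env -> R) (Q : m.-tuple M -> Prop) (P : Prop) e :
  (forall d, phi (splice (iota n m) d e) = (`[< Q (cpre m (cshift n d)) >])%:R) ->
  (forall y y', Q y -> Q y' -> y = y') -> (P <-> exists y, Q y) ->
  intl x (iota n m) phi e = (`[< P >])%:R.
Proof.
move=> Hphi Q1 PQ.
have [Pt|Pf] := pselect P; last first.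
  (* The integrand vanishes, which is the case of mass 0 placed at an arbitrary point. *)
  apply: (intl_delta x (y := fun=> 0%N)); first exact: iota_uniq.
  move=> d; rewrite Hphi !asboolF ?if_same //.
  by move=> Qd; apply: Pf; apply/PQ; exists (cpre m (cshift n d)).
have [y Qy] := PQ.1 Pt.
apply: (@intl_delta R x _ _ _ (fun j => nth 0%N (y : seq nat) (j - n)%N)).
  exact: iota_uniq.
move=> d; rewrite Hphi (asboolT Pt); case: ifP => [/pre_shiftP -> | /negP nd].
  by rewrite asboolT.
by rewrite asboolF // => Qd; apply/nd/pre_shiftP/(Q1 _ _ Qd Qy).
Qed.

Lemma intl_shift_ind n m (B : set (m.-tuple M)) e :
  intl x (iota n m) (fun d => ind B (cshift n d)) e = chi B.
Proof.
rewrite -[in iota n m](addn0 n) iotaDl.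
rewrite [LHS](intl_ren x (iota 0 m) (ind B) e (@addnI n)).
by apply: intl_agree => d; rewrite /ind !(@pre_shift_splice 0 m).
Qed.

(** Both sides are iterated integrals of the indicator [phi] of the graph, with the two blocks of
    coordinates integrated in opposite orders. *)
Lemma chi_bij n m (A : set (n.-tuple M)) (B : set (m.-tuple M)) :
  definably_bijective A B -> chi A = chi B.
Proof.
move=> /def_bijP[G [dG GAB [Gl Gr] Gf Gi]].
pose phi (e : env) : R := (`[< G (cpre n e) (cpre m (cshift n e)) >])%:R.
have bphi : basic N phi by apply/basic_bool/basic_dp.
have EA : intl x (iota n m) phi = ind A.
  apply/funext => e; apply: (@intl_fun n m _ (G (cpre n e))).
  - by move=> d; rewrite /phi pre_splice_ge pre_shift_splice.
  - exact: Gf.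
  - by split=> [/Gl//|[y /GAB[]]].
have EB : intl x (iota 0 n) phi = (fun e => ind B (cshift n e)).
  apply/funext => e; apply: (@intl_fun 0 n _ (fun z => G z (cpre m (cshift n e)))).
  - by move=> d; rewrite /phi shift_splice (@pre_shift_splice 0 n).
  - by move=> y y'; apply: Gi.
  - by split=> [/Gr//|[y /GAB[]]].
by rewrite /chi -EA (intlC x charN _ _ bphi) EB intl_shift_ind.
Qed.

Lemma chi_prod n m (A : set (n.-tuple M)) (B : set (m.-tuple M)) :
  definable A -> definable B -> chi (setprod_tuple A B) = chi A * chi B.
Proof.
move=> dA dB; have bB : basic N (fun e => ind B (cshift n e)).
  exact: (basic_ren (addn n) (basic_ind dB)).
rewrite {1}/chi; have -> : ind (setprod_tuple A B) = fun e => ind A e * ind B (cshift n e).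
  apply/funext => e; rewrite /ind pre_cat -natrM mulnb; congr (nat_of_bool _)%:R.
  rewrite -asbool_and; apply: asbool_equiv_eq.
  split=> [[u Au [v Bv /cat_tupleI[<- <-]]]//|[Ae Be]].
  by exists (cpre n e) => //; exists (cpre m (cshift n e)).
(* The last [m] coordinates are integrated first, and [ind A] is constant along them. *)
rewrite iotaD add0n /intl foldr_cat -/(intl _ _ _) -/(intl _ _ _).
have -> : intl x (iota n m) (fun e => ind A e * ind B (cshift n e)) =
    (fun e => chi B * ind A e).
  apply/funext => e; rewrite (intlM x charN) ?intl_shift_ind 1?mulrC // => d.
  by rewrite /ind pre_splice_ge.
rewrite (intlM x charN (phi := fun=> chi B)) 1?mulrC //; exact: basic_ind.
Qed.

Lemma chi_setU n (A B : set (n.-tuple M)) : definable A -> definable B ->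
  (forall u, A u -> B u -> False) -> chi (A `|` B)%classic = chi A + chi B.
Proof.
move=> dA dB AB; rewrite /chi.
have -> : ind (A `|` B)%classic = fun e => ind A e + ind B e.
  apply/funext => e; rewrite /ind; set u := cpre n e.
  have [Au|nA] := pselect (A u).
    by rewrite (asboolT Au) (asboolF (AB _ Au)) asboolT ?addr0 //; left.
  rewrite (asboolF nA) add0r; congr (nat_of_bool _)%:R; apply: asbool_equiv_eq.
  by split=> [[]//|]; right.
by rewrite (intlD x charN) //; apply: basic_ind.
Qed.

(** Each tagged copy is a sum with the empty set, so invariance under bijections gives its integral;
    the two copies are disjoint subsets of one power, where additivity applies. *)
Lemma chi_sum (a b : M) n m (A : set (n.-tuple M)) (B : set (m.-tuple M)) :
  a <> b -> definable A -> definable B ->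
  chi (setsum_tuple a b A B) = chi A + chi B.
Proof.
move=> ab dA dB.
have E1 : chi (setsum_tuple a b A (@set0 (m.-tuple M))) = chi A.
  have d0 := definable0 M m.
  by rewrite (chi_bij (def_bij_sumC ab dA d0)) (chi_bij (def_bij_sum0 a b m dA)).
rewrite -E1 -(chi_bij (def_bij_sum0 a b n dB)) -chi_setU.
- by congr chi; rewrite /setsum_tuple !image_set0 setU0 set0U.
- apply: definable_sum dA _; exact: definable0.
- apply: definable_sum _ dB; exact: definable0.
- move=> u; rewrite /setsum_tuple !image_set0 setU0 set0U.
  by move=> [y _ <-] [z _ /esym/(inlr ab)].
Qed.

Lemma chi0 n : chi (@set0 (n.-tuple M)) = 0.
Proof.
apply: (intl_delta x (y := fun=> 0%N)); first exact: iota_uniq.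
by move=> d; rewrite /ind asboolF ?if_same //; case.
Qed.

Lemma chiT0 : chi [set: 0.-tuple M]%classic = 1.
Proof. by rewrite /chi /ind /= asboolT. Qed.

Lemma chiT1 : chi [set: 1.-tuple M]%classic = x.
Proof.
rewrite /chi /= /intv (_ : (fun a => _) = fun=> 1) ?int1_cst ?mulr1 //.
by apply/funext => a; rewrite /ind asboolT.
Qed.

End EulerCharacteristic.

(** * The morphism from K0 induced by the Euler characteristic *)

Section Morphism.
Variables (N : nat) (R : comPzRingType) (x : R).
Hypothesis charN : N%:R = 0 :> R.

Local Notation M := (chain N).

Lemma nontrivial_chain : nontrivial M.
Proof. by exists 0%N, 1%N. Qed.

Local Notation hM := nontrivial_chain.
Local Notation D := (DefTilde hM).

Definition chi_class (u : D) : R := chi x (repr u).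

Lemma chi_dclass A : chi_class (dclass hM A) = chi x A.
Proof. exact/(chi_bij x charN)/repr_dclass. Qed.

Lemma chi_classD u v : chi_class (u + v) = chi_class u + chi_class v.
Proof.
have [A ->] := dclassK u; have [B ->] := dclassK v.
rewrite [dclass hM A + _]dclass_add !chi_dclass.
apply: (chi_sum x charN); try exact: points_definable.
exact: svalP (cid (svalP (cid hM))).
Qed.

Lemma chi_classM u v : chi_class (u * v) = chi_class u * chi_class v.
Proof.
have [A ->] := dclassK u; have [B ->] := dclassK v.
rewrite [dclass hM A * _]dclass_mul !chi_dclass.
by apply: (chi_prod x charN); exact: points_definable.
Qed.

Lemma chi_class1 : chi_class 1 = 1.
Proof. by rewrite chi_dclass chiT0. Qed.

Lemma chi_class0 : chi_class 0 = 0.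
Proof. by rewrite chi_dclass chi0. Qed.

Definition chi_canc (u : canc D) : R := chi_class (repr u).

(** Passing to the cancellative quotient is compatible with [chi_class] because addition in [R] is
    cancellative. *)
Lemma chi_cclass u : chi_canc (cclass u) = chi_class u.
Proof.
have [z E] := repr_cclass u; apply: (@addIr _ (chi_class z)).
by rewrite -!chi_classD E.
Qed.

Lemma chi_cancD u v : chi_canc (u + v) = chi_canc u + chi_canc v.
Proof.
have [a ->] := cclassK u; have [b ->] := cclassK v.
by rewrite [cclass a + _]cclass_add !chi_cclass chi_classD.
Qed.

Lemma chi_cancM u v : chi_canc (u * v) = chi_canc u * chi_canc v.
Proof.
have [a ->] := cclassK u; have [b ->] := cclassK v.
by rewrite [cclass a * _]cclass_mul !chi_cclass chi_classM.
Qed.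

Definition chi_K0 (u : K0 hM) : R := chi_canc (repr u).1 - chi_canc (repr u).2.

Lemma chi_gclass p : chi_K0 (gclass p) = chi_canc p.1 - chi_canc p.2.
Proof.
rewrite /chi_K0; apply/eqP; rewrite subr_eq addrAC eq_sym subr_eq.
by rewrite -!chi_cancD (repr_gclass p).
Qed.

Lemma chi_K0_zmod_morphism : zmod_morphism chi_K0.
Proof.
move=> u v; have [p ->] := gclassK u; have [q ->] := gclassK v.
have -> : gclass p - gclass q = gclass (diff_add p (diff_opp q)).
  by rewrite [- _]gclass_opp [LHS]gclass_add.
by rewrite !chi_gclass /= !chi_cancD; ring.
Qed.

Lemma chi_K0_monoid_morphism : monoid_morphism chi_K0.
Proof.
split=> [|u v].
  by rewrite chi_gclass /= !chi_cclass chi_class1 chi_class0 subr0.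
have [p ->] := gclassK u; have [q ->] := gclassK v.
rewrite [gclass p * _]gclass_mul !chi_gclass /= !chi_cancD !chi_cancM; ring.
Qed.

HB.instance Definition _ :=
  GRing.isZmodMorphism.Build (K0 hM) R chi_K0 chi_K0_zmod_morphism.
HB.instance Definition _ :=
  GRing.isMonoidMorphism.Build (K0 hM) R chi_K0 chi_K0_monoid_morphism.

Definition kclass (A : dset M) : K0 hM := gclass (cclass (dclass hM A), 0).

Definition dline : dset M := DSet (definableT M 1).

Lemma K0_morphism : exists f : {rmorphism K0 hM -> R}, f (kclass dline) = x.
Proof.
exists chi_K0; rewrite [LHS]chi_gclass /= !chi_cclass chi_class0 subr0 chi_dclass.
by rewrite chiT1.
Qed.

End Morphism.

(** * Generation of K0 by the class of the line *)

Section Generation.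
Variable N : nat.
Hypothesis N_gt0 : (0 < N)%N.

Local Notation M := (chain N).
Local Notation env := (nat -> nat).
Local Notation cons a e := (@consenv chain_sig M a e).
Local Notation cpre n e := (@pre chain_sig M n e).
Local Notation cdp P := (@dp chain_sig M P).
Local Notation hM := (nontrivial_chain N).
Local Notation X := (kclass (dline N)).
Implicit Types (P Q : env -> Prop).

Lemma kclass_bij (A B : dset M) : definably_bijective A B -> kclass A = kclass B.
Proof. by move=> /(dclassP hM) AB; rewrite /kclass AB. Qed.

Lemma kclassM (A B : dset M) : kclass (dset_mul A B) = kclass A * kclass B.
Proof.
rewrite [RHS]gclass_mul /diff_mul /= !mulr0 !mul0r !addr0.
by rewrite [cclass _ * _]cclass_mul [dclass hM A * _]dclass_mul.
Qed.

Lemma kclassU n (A B C : set (n.-tuple M)) (dA : definable A) (dB : definable B)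
    (dC : definable C) : (forall z, C z <-> A z \/ B z) ->
  (forall z, A z -> B z -> False) ->
  kclass (DSet dC) = kclass (DSet dA) + kclass (DSet dB).
Proof.
move=> HC AB; have E : C = (A `|` B)%classic by apply/funext => z; apply/propext/HC.
subst C; rewrite [RHS]gclass_add /diff_add /= addr0 [cclass _ + _]cclass_add.
rewrite -dclassU //; apply/seteqP; split=> z; last by [].
by case=> /AB.
Qed.

Lemma kclass_diff (u : K0 hM) : exists A B, u = kclass A - kclass B.
Proof.
have [[a b] ->] := gclassK u; have [a' ->] := cclassK a; have [b' ->] := cclassK b.
have [A ->] := dclassK a'; have [B ->] := dclassK b'; exists A, B.
by rewrite [- _]gclass_opp [RHS]gclass_add /diff_add /= addr0 add0r.
Qed.

Lemma kclass_empty n (A : set (n.-tuple M)) (dA : definable A) :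
  (forall z, ~ A z) -> kclass (DSet dA) = 0.
Proof.
move=> nA; apply: (@addrI _ (kclass (DSet dA))); rewrite addr0.
by apply/esym/kclassU => z; [split=> [|[]] // ?; left|move=> /nA].
Qed.

Lemma kclass_unit (A : set (0.-tuple M)) (dA : definable A) :
  A [tuple] -> kclass (DSet dA) = 1.
Proof.
move=> A0; apply: (@kclass_bij _ (dset1 M)) => /=.
suff -> : A = [set: 0.-tuple M]%classic by apply: def_bij_refl; apply: definableT.
by apply/seteqP; split=> // z _; rewrite (tuple0 z).
Qed.

Lemma dp_ren P (f : nat -> nat) : cdp P -> cdp (fun e => P (e \o f)).
Proof.
move=> [k [phi H]].
have d : definable [set z | holds phi z]%classic by exists phi.
apply: dp_ext (dp_set d (t := fun e : nat -> M => pre k (e \o f)) _) => [e|].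
  by rewrite /= -H.
by apply: simple_pre_of => i; exists (f i).
Qed.

Lemma dp_cons P a : cdp P -> cdp (fun e => P (cons a e)).
Proof.
move=> [k [phi H]].
have d : definable [set z | holds phi z]%classic by exists phi.
apply: dp_ext (dp_set d (t := fun e : nat -> M => pre k (consenv a e)) _) => [e|].
  by rewrite /= -H.
move=> [[|i] ik]; last by left; exists i => e; rewrite (tnth_pre, tnth_mktuple).
by right; exists a => e; rewrite (tnth_pre, tnth_mktuple).
Qed.

Lemma dp_step i j k : cdp (fun e => e j = (e i + N * k)%N).
Proof.
have im : (i < (maxn i j).+1)%N by rewrite ltnS leq_maxl.
have jm : (j < (maxn i j).+1)%N by rewrite ltnS leq_maxr.
exists (maxn i j).+1, (@FRel chain_sig M _ k (fun l : 'I_2 =>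
  if l == ord0 then Var M (Ordinal im) else Var M (Ordinal jm))) => e /=.
by rewrite !tnth_mktuple /= ?(tnth_pre, tnth_mktuple).
Qed.

Lemma dp_val i c : cdp (fun e => e i = c).
Proof.
exists i.+1, (FEq (Var M ord_max) (Par (c : M))) => e /=.
by rewrite (tnth_pre, tnth_mktuple).
Qed.

Lemma dp_false : cdp (fun=> False).
Proof. by apply: dp_ext (dp_not (dp_true M)) => e; split=> // -[]. Qed.

(** Environments [e \o S] forget [x_0]. A negative shift is read as a step in the opposite
    direction, and a negative constant has no solution. *)
Lemma dp_zval t : cdp (fun e => zval N (e \o S) t = (e 0%N)%:Z).
Proof.
case: t => [[j|] [k|k]]; rewrite /zval /=.
- by apply: dp_ext (dp_step j.+1 0 k) => e /=; lia.
- by apply: dp_ext (dp_step 0 j.+1 k.+1) => e /=; rewrite NegzE; lia.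
- by apply: dp_ext (dp_val 0 k) => e /=; split=> [->|[]].
- by apply: dp_ext dp_false => e /=; split.
Qed.

(** Tuples are padded with zeros to environments, so that a single notion of definable predicate
    serves in every dimension. *)
Definition denv n P : set (n.-tuple M) := [set z | P (nth 0%N (z : seq nat))]%classic.

Lemma pre_nth n (z : n.-tuple M) : cpre n (nth 0%N (z : seq nat)) = z.
Proof. by apply: eq_from_tnth => i; rewrite (tnth_pre, tnth_mktuple) (tnth_nth (0%N : M)). Qed.

Lemma definable_denv n P : cdp P -> definable (@denv n P).
Proof.
move=> [k [phi H]]; apply: dp_definable.
have d : definable [set z | holds phi z]%classic by exists phi.
pose t (e : nat -> M) : k.-tuple M := pre k (nth (0%N : M) (pre n e)).
apply: dp_ext (dp_set d (t := t) _) => [e|i]; first by rewrite /denv /= H.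
case: (ltnP i n) => ni; [left; exists i|right; exists 0%N] => e; rewrite (tnth_pre, tnth_mktuple).
  by rewrite -[RHS](tnth_pre e (Ordinal ni)) (tnth_nth (0%N : M)).
by rewrite nth_default ?size_tuple.
Qed.

Lemma nth_cons_env n a (z : n.-tuple M) :
  nth 0%N (a :: z : seq nat) = cons a (nth 0%N (z : seq nat)).
Proof. by apply/funext => -[|i]. Qed.

Definition kenv n P (dP : cdp P) : K0 hM := kclass (DSet (definable_denv n dP)).

Lemma kenvU n P Q Q' (dP : cdp P) (dQ : cdp Q) (dQ' : cdp Q') :
  (forall e, P e <-> Q e \/ Q' e) -> (forall e, Q e -> Q' e -> False) ->
  kenv n dP = kenv n dQ + kenv n dQ'.
Proof. by move=> H H'; apply: kclassU => z; [apply: H|apply: H']. Qed.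

(** Forgetting the first coordinate is the required bijection; it is injective because [t] computes
    that coordinate from the others. *)
Lemma kenv_graph n P (dP : cdp P) t :
  (forall e, P e -> zval N (e \o S) t = (e 0%N)%:Z) ->
  kenv n.+1 dP = kenv n (dp_ex1 dP).
Proof.
move=> Pt; apply: kclass_bij; apply/def_bijP => /=.
exists (fun z y => denv P z /\ exists a : 1.-tuple M, z = cat_tuple a y); split.
- apply: dp_and; first by apply: (dp_set (definable_denv n.+1 dP)); simple_tac.
  by apply: dp_ex; apply: dp_eq; simple_tac.
- move=> z y [Pz [a Ez]]; split=> //; exists (thead a).
  move: Pz; rewrite /denv /= Ez; case/tupleP: a {Ez} => a b.
  by rewrite (tuple0 b) theadE /= nth_cons_env.
- split=> [z Pz|y [a Pa]].
    case/tupleP: z Pz => a z Pz; exists z; split=> //; exists [tuple a].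
    by apply: val_inj.
  exists [tuple of a :: y]; split; first by rewrite /denv /= nth_cons_env.
  by exists [tuple a]; apply: val_inj.
- by move=> z y y' [_ [a ->]] [_ [a' /cat_tupleI[]]].
- move=> z z' y [Pz [a Ez]] [Pz' [a' Ez']]; move: Pz Pz'; rewrite /denv /= Ez Ez'.
  case/tupleP: a {Ez} => a b; case/tupleP: a' {Ez'} => a' b'.
  rewrite (tuple0 b) (tuple0 b') /= !nth_cons_env => /Pt E /Pt E'.
  have {E E'} : a%:Z = a'%:Z by rewrite -[LHS]E -[RHS]E'.
  by case=> ->.
Qed.

Lemma kenv_line n P (dP : cdp P) : (forall a e, P (cons a e) <-> P (cons 0%N e)) ->
  kenv n.+1 dP = X * kenv n (dp_cons 0%N dP).
Proof.
move=> H; rewrite -kclassM; apply: kclass_bij => /=.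
suff -> : denv P = setprod_tuple [set: 1.-tuple M]%classic
    (denv (n := n) (fun e => P (cons 0%N e))).
  apply: def_bij_refl.
  exact: (definable_prod (definableT M 1) (definable_denv n (dp_cons 0%N dP))).
apply/seteqP; split=> [z|z [a _ [y Py <-]]].
  case/tupleP: z => a z Pz; exists [tuple a] => //; exists z; last exact: val_inj.
  by apply/(H a); move: Pz; rewrite /denv /= nth_cons_env.
case/tupleP: a => a b; rewrite (tuple0 b) /denv /= nth_cons_env.
exact/H.
Qed.

(** Natural coefficients suffice, as [-1 = N - 1] in [K0]. *)
Definition gen (u : K0 hM) : Prop :=
  exists m (c : nat -> nat), u = \sum_(i < m) (c i)%:R * X ^+ i.

Lemma gen0 : gen 0.
Proof. by exists 0%N, (fun=> 0%N); rewrite big_ord0. Qed.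

Lemma gen1 : gen 1.
Proof. by exists 1%N, (fun=> 1%N); rewrite big_ord1 mul1r. Qed.

Lemma genD u v : gen u -> gen v -> gen (u + v).
Proof.
move=> [m [c ->]] [m' [c' ->]]; exists (maxn m m').
exists (fun i => (i < m) * c i + (i < m') * c' i)%N.
have W k (d : nat -> nat) : (k <= maxn m m')%N -> \sum_(i < k) (d i)%:R * X ^+ i =
    \sum_(i < maxn m m') ((i < k) * d i)%:R * X ^+ i.
  move=> km; rewrite (big_ord_widen _ (fun i => (d i)%:R * X ^+ i) km) big_mkcond.
  by apply: eq_bigr => i _; case: (i < k)%N; rewrite (mul1n, mul0n) ?mul0r.
rewrite (W m c) ?leq_maxl // (W m' c') ?leq_maxr // -big_split.
by apply: eq_bigr => i _; rewrite natrD mulrDl.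
Qed.

Lemma genX u : gen u -> gen (X * u).
Proof.
move=> [m [c ->]]; exists m.+1, (fun i => if i is j.+1 then c j else 0%N).
rewrite big_ord_recl mul0r add0r mulr_sumr; apply: eq_bigr => i _.
by rewrite exprS mulrCA.
Qed.

Lemma dp_ltn k : cdp (fun e => (e 0 < k)%N).
Proof.
elim: k => [|k IH]; first by apply: dp_ext dp_false => e.
by apply: dp_ext (dp_or IH (dp_val 0 k)) => e; lia.
Qed.

Lemma kenv_ltn k (dP : cdp (fun e => (e 0 < k)%N)) : kenv 1 dP = k%:R.
Proof.
elim: k dP => [|k IH] dP; first exact: kclass_empty.
rewrite (kenvU 1 dP (dp_ltn k) (dp_val 0 k)).
- rewrite IH -[k.+1]addn1 natrD; congr (_ + _).
  (* A singleton of the line is the graph of a constant term over the one-point power. *)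
  rewrite (@kenv_graph 0 _ _ (None, k%:Z)); last by move=> e ->.
  by apply: kclass_unit; exists k.
- by move=> e; lia.
- by move=> e lt E; rewrite E ltnn in lt.
Qed.

Lemma kclass_char : N%:R = 0 :> K0 hM.
Proof.
have dge : cdp (fun e => ~ (e 0 < N)%N) := dp_not (dp_ltn N).
have E1 : kenv 1 (dp_true M) = kenv 1 dge + kenv 1 (dp_ltn N).
  apply: kenvU => e //; split=> // _.
  by case: (boolP (e 0 < N)%N); [right|left].
suff E2 : kenv 1 (dp_true M) = kenv 1 dge.
  by apply: (@addrI _ (kenv 1 dge)); rewrite addr0 -[RHS]E2 E1 kenv_ltn.
apply: kclass_bij; apply/def_bijP => /=.
exists (fun z y : 1.-tuple M => tnth y ord0 = (tnth z ord0 + N * 1)%N); split.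
- by apply: dp_ext (dp_step 0 1 1) => e; rewrite !tnth_mktuple.
- move=> z y E; split=> //; rewrite /denv /= -(tnth_nth 0%N y ord0) E; lia.
- split=> [z _|y]; first by exists [tuple (tnth z ord0 + N * 1)%N : M]; rewrite tnth0.
  rewrite /denv /= -(tnth_nth 0%N y ord0) => ge.
  by exists [tuple (tnth y ord0 - N)%N : M]; rewrite tnth0 muln1 subnK // leqNgt; apply/negP.
- by move=> z y y' E E'; apply: eq_from_tnth => i; rewrite (ord1 i) E E'.
- move=> z z' y E E'; apply: eq_from_tnth => i; rewrite (ord1 i).
  by apply: (@addIn (N * 1)); rewrite -E -E'.
Qed.

Lemma genN u : gen u -> gen (- u).
Proof.
move=> [m [c ->]]; exists m, (fun i => N.-1 * c i)%N.
rewrite -sumrN; apply: eq_bigr => i _; rewrite natrM -mulrA -[LHS]mulN1r.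
congr (_ * _); apply/esym/eqP; rewrite -addr_eq0.
by rewrite -[X in _ + X]/(1%:R) -natrD addn1 prednK // kclass_char.
Qed.

Lemma dp_avoids T : cdp (fun e => avoids N (e \o S) T (e 0%N)).
Proof.
elim: T => [|t T IH]; first by apply: dp_ext (dp_true M).
apply: dp_ext (dp_and (dp_not (dp_zval t)) IH) => e; split=> [[H H'] s|H].
  by rewrite inE => /orP[/eqP->|/H'].
by split=> [|s sT]; apply: H; rewrite inE ?eqxx ?sT ?orbT.
Qed.

(** Removing [t] from the list of exceptional terms: [P] is changed on the graph
    of [t], where it is given the generic truth value [g] of the fibre. *)
Lemma gen_exceptional n : (forall P (dP : cdp P), gen (kenv n dP)) ->
  forall T P (dP : cdp P), (forall e a a', avoids N e T a -> avoids N e T a' ->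
    P (cons a e) -> P (cons a' e)) -> gen (kenv n.+1 dP).
Proof.
move=> IHn; elim=> [|t T IHT] P dP exc.
  (* With no exceptional term left, every point is generic and [P] does not depend on [x_0]. *)
  by rewrite kenv_line => [|a e]; [apply/genX/IHn|split; apply: exc].
pose D e := zval N (e \o S) t = (e 0%N)%:Z.
have dD : cdp D := dp_zval t.
(* The common truth value of [P] at generic points of the fibre, written with a quantifier so that
   it is definable. *)
pose g e := exists a, avoids N e (t :: T) a /\ P (cons a e).
have dg : cdp (fun e => g (e \o S)).
  exact: (dp_ren S (dp_ex1 (dp_and (dp_avoids (t :: T)) dP))).
pose d0 := dp_and dP dD; pose d1 := dp_and dP (dp_not dD); pose d2 := dp_and dg dD.
have E : kenv n.+1 dP = kenv n.+1 d0 + kenv n.+1 d1.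
  apply: kenvU => e; last by case=> _ De [_ /(_ De)].
  by split=> [Pe|[[]|[]]//]; have [De|nDe] := pselect (D e); [left|right].
have E' : kenv n.+1 (dp_or d1 d2) = kenv n.+1 d1 + kenv n.+1 d2.
  by apply: kenvU => e //; case=> _ nDe [_ /nDe].
(* [d0] and [d2] lie on the graph of [t], so their classes come from [n] variables, while
   [dp_or d1 d2] has one exceptional term fewer. *)
have -> : kenv n.+1 dP = kenv n.+1 d0 + (kenv n.+1 (dp_or d1 d2) - kenv n.+1 d2).
  by rewrite E E' addrK.
apply: genD; last apply: genD; last apply: genN.
- by rewrite (@kenv_graph _ _ _ t) => [|e []].
- apply: IHT => e a a' Ha Ha'.
  have avo b : avoids N e T b -> ~ D (cons b e) -> avoids N e (t :: T) b.
    by move=> Hb nD s; rewrite inE => /orP[/eqP-> //|/Hb].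
  move=> H; have [Da'|nDa'] := pselect (D (cons a' e)).
    right; split=> //; case: H => [[Pa nDa]|[]//].
    by exists a; split=> //; apply: avo.
  left; split=> //; case: H => [[Pa nDa]|[[b [Hb Pb]] _]].
    by apply: exc Pa; apply: avo.
  by apply: exc Hb _ Pb; apply: avo.
- by rewrite (@kenv_graph _ _ _ t) => [|e []].
Qed.

Lemma gen_kenv n P (dP : cdp P) : gen (kenv n dP).
Proof.
elim: n P dP => [|n IH] P dP.
  have [P0|nP0] := pselect (P (nth 0%N [::])).
    by rewrite /kenv kclass_unit //; apply: gen1.
  rewrite /kenv kclass_empty; first exact: gen0.
  by move=> z; rewrite (tuple0 z).
have [L HL] := basic_dp dP; have [L' [T HT]] := elim_var N L.
apply: (gen_exceptional IH (T := T)) => e a a' Ha Ha'.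
(* Comparing [e] with itself shows that all generic points of one fibre satisfy the same atoms. *)
have [gn _ _ _] := HT e e (fun p _ => erefl).
by rewrite (HL _ _ (gn _ _ Ha Ha')).
Qed.

Lemma gen_K0 u : gen u.
Proof.
have W (A : dset M) : gen (kclass A).
  case: A => n A dA; have dP := dp_set dA (@simple_pre _ M n).
  suff -> : kclass (DSet dA) = kenv n dP by apply: gen_kenv.
  apply: kclass_bij => /=.
  suff -> : denv (fun e => A (cpre n e)) = A by apply: def_bij_refl.
  by apply/funext => z; rewrite /denv /= pre_nth.
have [A [B ->]] := kclass_diff u; apply: genD => //; exact: genN.
Qed.

(** * The isomorphism *)

(** The hypotheses say that the powers of [x] form a basis of [R] over the integers modulo [N], with
    natural coefficients so that the zero ring is covered too. A kernel element is a polynomial in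
    [X] with coefficients divisible by [N], hence zero, as [N = 0] in [K0]. *)
Lemma K0_iso (R : comPzRingType) (x : R) : N%:R = 0 :> R ->
  (forall m (c : nat -> nat), \sum_(i < m) (c i)%:R * x ^+ i = 0 ->
    forall i, (i < m)%N -> (N %| c i)%N) ->
  (forall r : R, exists m (c : nat -> nat), r = \sum_(i < m) (c i)%:R * x ^+ i) ->
  exists f : {rmorphism K0 hM -> R}, bijective f.
Proof.
move=> charN free span; have [f fX] := K0_morphism x charN; exists f.
have fsum m (c : nat -> nat) : f (\sum_(i < m) (c i)%:R * X ^+ i) =
    \sum_(i < m) (c i)%:R * x ^+ i.
  by rewrite rmorph_sum; apply: eq_bigr => i _; rewrite rmorphM rmorphXn rmorph_nat fX.
have inj : injective f.
  move=> u v Euv; apply/eqP; rewrite -subr_eq0; apply/eqP.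
  have : f (u - v) = 0 by rewrite rmorphB Euv subrr.
  have [m [c ->]] := gen_K0 (u - v); rewrite fsum => /free Hc.
  rewrite big1 // => i _; have /dvdnP[q ->] := Hc i (ltn_ord i).
  by rewrite natrM kclass_char mulr0 mul0r.
have /choice[h hK] r : exists u, f u = r.
  by have [m [c ->]] := span r; exists (\sum_(i < m) (c i)%:R * X ^+ i); rewrite fsum.
by exists h => // u; apply: inj.
Qed.

End Generation.

Theorem theorem1p3 : forall N : nat, (0 < N)%N ->
  exists (L : signature) (M : structure L) (hM : nontrivial M)
    (f : {rmorphism K0 hM -> poly_Zmod N}), bijective f.
Proof.
move=> N N_gt0; exists chain_sig, (chain N), (nontrivial_chain N).
(* For [N = 1] the only element of the zero ring serves as [x], and divisibility of the coefficients
   is trivial; for larger [N] the indeterminate is used. *)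
case: N N_gt0 => [//|[|n]] N_gt0.
  have Z (u v : zero_ring) : u = v by case: u; case: v.
  apply: (@K0_iso 1 N_gt0 zero_ring tt); first exact: Z.
    by move=> m c _ i _; apply: dvd1n.
  by move=> r; exists 0%N, (fun=> 0%N); apply: Z.
apply: (@K0_iso n.+2 N_gt0 {poly 'Z_n.+2} 'X).
- by rewrite -polyC_natr pchar_Zp.
- move=> m c E i im; move/polyP/(_ i): E; rewrite coef0 coef_sum.
  rewrite (bigD1 (Ordinal im)) //= big1 ?addr0.
    rewrite -polyC_natr coefCM coefXn eqxx mulr1 => /(congr1 val).
    by rewrite /= val_Zp_nat // => /eqP.
  move=> j ne; rewrite -polyC_natr coefCM coefXn.
  rewrite [i == j]eq_sym -[(j : nat) == i]/(j == Ordinal im) (negPf ne).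
  by rewrite mulr0.
- move=> r; set p : {poly 'Z_n.+2} := r; exists (size p), (fun i => nat_of_ord p`_i).
  rewrite -[LHS](coefK p) poly_def; apply: eq_bigr => i _.
  by rewrite -mul_polyC -polyC_natr natr_Zp.
Qed.
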